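(* In the causal setting of the context, assume consistency, ignorability and overlap. Let $g:\mathcal W\times[0,1]^{d_U}\to\mathcal Y$ be a measurable generator and let $P_g(dw,dy)=Q_\rho(dw)\nu_{g,w}(dy)$ with $\nu_{g,w}=g(w,\cdot)_\#U$. For a critic $h$ put $$L(g,h)=\mathbb E_{P_{\mathrm{obs}}}\big[w_\rho(W)\,h(W,Y^{\mathrm{obs}})\big]-\mathbb E\big[h(\tilde W,g(\tilde W,U))\big],$$ where $\tilde W\sim Q_\rho$ is independent of $U$. Then $$\sup_{h\in\mathcal F_{1,0}}L(g,h)=\mathrm{eW}_1(P^\ast,P_g).$$
   Context: All spaces are standard Borel and conditional distributions are fixed regular versions. $\mathcal Y\subset\mathbb R^p$ is compact with the Euclidean metric; $U\sim\mathrm{Unif}([0,1]^{d_U})$; $g(w,\cdot)_\#U$ is the law of $g(w,U)$. $X$ are covariates, $T$ a treatment, $Y(t)\in\mathcal Y$ potential outcomes, $W=(X,T)\in\mathcal W$, $Y^{\mathrm{obs}}$ the observed outcome. Consistency: $Y^{\mathrm{obs}}=Y(T)$ a.s. Ignorability: $Y(t)\perp T\mid X$ for each $t$. $Q_{\mathrm{obs}}$ is the law of $W$, and $Q_\rho$ a target law on $\mathcal W$. Overlap: $Q_\rho\ll Q_{\mathrm{obs}}$, with density ratio $w_\rho=dQ_\rho/dQ_{\mathrm{obs}}$ satisfying $0\le w_\rho\le\kappa^{-1}$ $Q_{\mathrm{obs}}$-a.s. for some $\kappa\in(0,1]$. For $w=(x,t)$, $\mu_w^\ast$ is the law of $Y(t)$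 given $X=x$; under consistency and ignorability the law of $(W,Y^{\mathrm{obs}})$ is $P_{\mathrm{obs}}(dw,dy)=Q_{\mathrm{obs}}(dw)\mu_w^\ast(dy)$. The target law is $P^\ast(dw,dy)=Q_\rho(dw)\mu_w^\ast(dy)$. Extended Wasserstein distance: for $P,R\in\mathcal P(\mathcal W\times\mathcal Y)$ with common $\mathcal W$-marginal $Q$, $\mathrm{eW}_1(P,R)=\inf_\alpha\int\|y-y'\|\,\alpha(dw,dy,dw',dy')$ over couplings $\alpha$ of $P$ and $R$ whose $(w,w')$-marginal is the image of $Q$ under $w\mapsto(w,w)$. Fix $y_0\in\mathcal Y$. $\mathcal L_1(\mathcal Y;y_0)$ is the set of 1-Lipschitz $f:\mathcal Y\to\mathbb R$ with $f(y_0)=0$, and $\mathcal F_{1,0}$ is the set of measurable $h:\mathcal W\times\mathcal Y\to\mathbb R$ with $h(w,\cdot)\in\mathcal L_1(\mathcal Y;y_0)$ for $Q_\rho$-a.e. $w$.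
   Formalization: Unless the treatment is a.s. in a countable set, the identity law(W,Y^obs)=Q_obs(dw)μ*_w(dy) asserted in the context is assumed, since ignorability for each t does not imply it: for T uniform on [0,1] and Y(t)=1{T=t} the claim fails. *)

(* Defs.v *)
From HB Require Import structures.
From mathcomp Require Import all_boot all_order all_algebra.
From mathcomp Require Import all_classical all_reals all_analysis.
From mathcomp Require Import measurable_realfun.

Set Implicit Arguments.
Unset Strict Implicit.
Unset Printing Implicit Defensive.

Import Order.TTheory GRing.Theory Num.Theory.
Import numFieldNormedType.Exports.

Local Open Scope classical_set_scope.
Local Open Scope ring_scope.

(* [T] is isomorphic, as a measurable space, to a Polish space with its Borel
   sigma-algebra; Polish spaces are presented by a complete separated
   (pseudo)metric with a countable base. *)
Definition standard_borel (R : realType) (d : measure_display)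
    (T : measurableType d) : Prop :=
  exists (S : completePseudoMetricType R) (f : T -> S),
    [/\ hausdorff_space S, @second_countable S, bijective f &
        forall B : set S, <<s @open S >> B <-> measurable (f @^-1` B)].

(* The subspace [A] of [T] with its Borel sigma-algebra. The point [a] only
   serves as the default element that measurable types carry. *)
Definition borel_sub (T : topologicalType) (A : set T) (a : set_type A) :
  Type := set_type A.

Section borel_sub.
Context (T : topologicalType) (A : set T) (a : set_type A).

HB.instance Definition _ := Choice.copy (borel_sub a) (set_type A).
HB.instance Definition _ := isPointed.Build (borel_sub a) a.
HB.instance Definition _ := Measurable.copy (borel_sub a)
  (g_sigma_algebraType (@open (set_type A) : set (set (borel_sub a)))).

End borel_sub.

Definition eucl_dist (R : realType) (p : nat) (x y : 'rV[R]_p) : R :=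
  Num.sqrt (\sum_(i < p) (x ord0 i - y ord0 i) ^+ 2).

Definition cube (R : realType) (d : nat) : set 'rV[R]_d :=
  [set u | forall i, 0 <= u ord0 i <= 1].

Lemma cube_0 (R : realType) (d : nat) : (0 : 'rV[R]_d) \in @cube R d.
Proof. by rewrite inE => i; rewrite mxE lexx ler01. Qed.

Definition cube0 (R : realType) (d : nat) : set_type (@cube R d) :=
  exist _ 0 (@cube_0 R d).

Notation unit_cube R d := (borel_sub (cube0 R d)).

Section pair_rv.
Context d d1 d2 (T : measurableType d) (T1 : measurableType d1)
  (T2 : measurableType d2) (f : {mfun T >-> T1}) (g : {mfun T >-> T2}).

Definition pair_rv (x : T) : T1 * T2 := (f x, g x).

Let measurable_pair_rv : measurable_fun setT pair_rv.
Proof. exact: measurable_fun_pair. Qed.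

HB.instance Definition _ := isMeasurableFun.Build _ _ _ _ pair_rv
  measurable_pair_rv.

End pair_rv.

(* [gen_kernel l g w] is the image of [l] under [g (w, .)]. *)
Section gen_kernel.
Context d d1 d2 (W : measurableType d) (V : measurableType d1)
  (Y : measurableType d2) (R : realType).
Variables (l : probability V R) (g : {mfun (W * V)%type >-> Y}).

Definition gen_section (w : W) (u : V) : Y := g (w, u).

Let measurable_gen_section w : measurable_fun setT (gen_section w).
Proof. by apply: measurableT_comp => //; exact: measurable_pair1. Qed.

HB.instance Definition _ w := isMeasurableFun.Build _ _ _ _ (gen_section w)
  (measurable_gen_section w).

Definition gen_kernel (w : W) : {measure set Y -> \bar R} :=
  distribution l (gen_section w).

Let measurable_gen_kernel B : measurable B ->
  measurable_fun setT (gen_kernel ^~ B).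
Proof.
move=> mB.
have mG : measurable (g @^-1` B).
  by rewrite -[X in measurable X]setTI; exact: measurable_funPT.
rewrite (_ : (fun w => _) = l \o xsection (g @^-1` B)).
  exact: measurable_fun_xsection.
apply/funext => w /=; rewrite /gen_kernel /distribution /pushforward/=.
congr (l _).
by apply/seteqP; split => u; rewrite /xsection/= inE.
Qed.

HB.instance Definition _ := isKernel.Build _ _ _ _ _ gen_kernel
  measurable_gen_kernel.

Let gen_kernel_prob w : gen_kernel w setT = 1%E.
Proof. exact: probability_setT. Qed.

HB.instance Definition _ := Kernel_isProbability.Build _ _ _ _ _
  gen_kernel gen_kernel_prob.

End gen_kernel.

(* The measure [Q(dw) k_w(dy)]. *)
Section semidirect.
Context d d' (W : measurableType d) (Y : measurableType d') (R : realType).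
Variables (Q : probability W R) (k : R.-pker W ~> Y).
Local Open Scope ereal_scope.

Definition semidirect (A : set (W * Y)) : \bar R :=
  \int[Q]_w k w (xsection A w).

Let semidirect0 : semidirect set0 = 0.
Proof.
by rewrite /semidirect integral0_eq// => w _; rewrite xsection0 measure0.
Qed.

Let semidirect_ge0 A : 0 <= semidirect A.
Proof. exact: integral_ge0. Qed.

Let semidirect_sigma_additive : semi_sigma_additive semidirect.
Proof.
move=> F mF tF mUF; rewrite [X in _ --> X](_ : _ =
    \sum_(0 <= n <oo) semidirect (F n)).
  exact: is_cvg_nneseries.
rewrite /semidirect -integral_nneseries//.
  apply: eq_integral => w _; rewrite xsection_bigcup.
  apply/esym/cvg_lim => //.
  apply: measure_semi_sigma_additive.
  - by move=> n; exact: measurable_xsection.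
  - exact: trivIset_xsection.
  - by apply: bigcupT_measurable => n; exact: measurable_xsection.
by move=> n; apply: measurable_fun_xsection_finite_kernel; rewrite inE.
Qed.

HB.instance Definition _ := isMeasure.Build _ _ _ semidirect
  semidirect0 semidirect_ge0 semidirect_sigma_additive.

Let semidirect_setT : semidirect setT = 1.
Proof.
rewrite /semidirect (eq_integral (cst 1)) => [|w _]; last first.
  by rewrite -setXTT in_xsectionX ?inE// prob_kernel.
by rewrite integral_cst// [X in (_ * X)%E]probability_setT mule1.
Qed.

HB.instance Definition _ := Measure_isProbability.Build _ _ _ semidirect
  semidirect_setT.

End semidirect.

(* The coordinates of [U] are independent and uniform on [0, 1]. *)
Definition uniform_on_cube (R : realType) (d : measure_display)
    (T : measurableType d) (P : probability T R) (n : nat)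
    (U : T -> unit_cube R n) : Prop :=
  forall B : 'I_n -> set R, (forall i, measurable (B i)) ->
    P [set x | forall i, B i (set_val (U x) ord0 i)] =
    (\prod_(i < n) uniform_prob (@ltr01 R) (B i))%E.

Definition indep_rv (R : realType) (d d1 d2 : measure_display)
    (T : measurableType d) (T1 : measurableType d1) (T2 : measurableType d2)
    (P : probability T R) (f : T -> T1) (g : T -> T2) : Prop :=
  forall (A : set T1) (B : set T2), measurable A -> measurable B ->
    P (f @^-1` A `&` g @^-1` B) = (P (f @^-1` A) * P (g @^-1` B))%E.

Section conditioning.
Context (R : realType) d dX (O : measurableType d) (X : measurableType dX).
Variables (P : probability O R) (x : {RV P >-> X}).
Local Open Scope ereal_scope.

(* [f] is a version of [P(E | x = .)]. *)
Definition cond_prob_version (E : set O) (f : X -> \bar R) : Prop :=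
  [/\ measurable_fun setT f, (forall a, 0 <= f a) &
      forall A : set X, measurable A ->
        P (x @^-1` A `&` E) = \int[distribution P x]_(a in A) f a].

(* [k] is a regular version of the conditional law of [y] given [x]. *)
Definition regular_cond_law dY (Y : measurableType dY) (y : O -> Y)
    (k : X -> {measure set Y -> \bar R}) : Prop :=
  forall B : set Y, measurable B -> cond_prob_version (y @^-1` B) (k ^~ B).

(* [P(y in B, z in C | x) = P(y in B | x) P(z in C | x)] almost surely. *)
Definition cond_indep dY dZ (Y : measurableType dY) (Z : measurableType dZ)
    (y : O -> Y) (z : O -> Z) : Prop :=
  forall (B : set Y) (C : set Z), measurable B -> measurable C ->
  forall f g h : X -> \bar R,
    cond_prob_version (y @^-1` B) f ->
    cond_prob_version (z @^-1` C) g ->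
    cond_prob_version (y @^-1` B `&` z @^-1` C) h ->
    ae_eq (distribution P x) setT h (fun a => f a * g a).

End conditioning.

Section transport.
Context (R : realType) (p : nat) (Yset : set 'rV[R]_p) (y0 : set_type Yset).
Context dW (W : measurableType dW).
Notation Y := (borel_sub y0).
Local Open Scope ereal_scope.

(* Couplings of [P] and [P'] whose (w, w')-marginal is the image of the
   [W]-marginal of [P] under the diagonal map. *)
Definition ext_coupling (P P' : probability (W * Y)%type R)
    (a : probability ((W * Y) * (W * Y))%type R) : Prop :=
  [/\ forall A, measurable A -> a (fst @^-1` A) = P A,
      forall A, measurable A -> a (snd @^-1` A) = P' A &
      forall C : set (W * W), measurable C ->
        a [set z | C (z.1.1, z.2.1)] = P [set z | C (z.1, z.1)]].

Definition eW1 (P P' : probability (W * Y)%type R) : \bar R :=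
  ereal_inf [set \int[a]_z (eucl_dist (set_val z.1.2) (set_val z.2.2))%:E
            | a in ext_coupling P P'].

Definition lip1_0 (f : Y -> R) : Prop :=
  (forall y y' : Y, `|f y - f y'| <= eucl_dist (set_val y) (set_val y'))%R /\
  f (y0 : Y) = 0%R.

Definition critics (Q : probability W R) : set (W * Y -> R) :=
  [set h | measurable_fun setT h /\
           {ae Q, forall w, lip1_0 (fun y => h (w, y))}].

Definition objective d d' (O : measurableType d) (P : probability O R)
    (O' : measurableType d') (P' : probability O' R) dV (V : measurableType dV)
    (w : O -> W) (yobs : O -> Y) (w' : O' -> W) (u : O' -> V)
    (rho : W -> R) (g : W * V -> Y) (h : W * Y -> R) : \bar R :=
  'E_P[fun o => (rho (w o) * h (w o, yobs o))%R]
  - 'E_P'[fun o => h (w' o, g (w' o, u o))].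

End transport.

(* Main.v *)
From HB Require Import structures.
Require Import Defs.
From mathcomp Require Import all_boot all_order all_algebra.
From mathcomp Require Import all_classical all_reals all_analysis.
From mathcomp Require Import measurable_realfun ring lra.

Set Implicit Arguments.
Unset Strict Implicit.
Unset Printing Implicit Defensive.

Import Order.TTheory GRing.Theory Num.Theory.
Import numFieldNormedType.Exports.

Local Open Scope classical_set_scope.
Local Open Scope ring_scope.

(* The critic objective is [int h dP* - int h dPg]: ignorability and consistency
   give the law of the observed data, and reweighting by [rho] turns it into
   [P*]. The theorem thus is Kantorovich duality, conditionally on [w], with a
   potential and a plan that depend measurably on [w].

   Up to [eps], the outcome space is a finite set of cells, and at each [w] one
   has a finite transport problem between the cell masses of [mu_w] and [nu_w].
   Penalising the marginal constraints quadratically gives a minimisation over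
   a cube, whose first-order conditions yield a plan and a potential that
   are both almost optimal. After rounding, the candidates (plan, potential)
   range over a countable set, and taking the first one that is good for [w] is
   a measurable choice. The partial plan is completed into a density with
   respect to [mu_w x nu_w] that is constant on products of cells, which defines
   the coupling; the potential [v] extends to the critic
   [min_j (v_j + |y - c_j|)], recentred at [y0].

   Conversely [h(w,y) - h(w',y') <= |y - y'|] holds almost surely under any
   admissible coupling: the diagonal of a standard Borel space is measurable, so
   [w = w'] almost surely. *)

(** * Integration against densities and semidirect products *)

(** The obstacle is measurability in [w]: an optimal plan and potential exist for each [w], but
    nothing makes their choice measurable. Equality of a supremum and an infimum needs only pairs
    with gap at most [eps], and a grid of one fixed step serves all pairs of marginals at once, so
    countably many candidates suffice. Exact marginals do not survive rounding. Candidates therefore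
    satisfy inequalities only: their marginals lie below the cell masses and a small, strictly
    positive amount of mass is missing. The missing mass is filled in afterwards by an explicit
    formula, measurable in the cell masses. The quadratic penalty is the device that yields primal
    and dual together: a continuous function on a compact box has a minimiser, and perturbing one
    entry of it gives dual feasibility and complementary slackness. The price is a marginal defect
    that tends to 0 with the penalty parameter. *)

Section integral_functional.
Context d (T : measurableType d) (R : realType).
Variables (m : {measure set T -> \bar R}) (Phi : (T -> \bar R) -> \bar R).
Local Open Scope ereal_scope.

Hypothesis Phi_indic : forall A, measurable A ->
  Phi (fun x => (\1_A x)%:E) = m A.
Hypothesis PhiD : forall f g : T -> \bar R,
  measurable_fun setT f -> measurable_fun setT g ->
  (forall x, 0 <= f x) -> (forall x, 0 <= g x) ->
  Phi (fun x => f x + g x) = Phi f + Phi g.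
Hypothesis PhiZ : forall (r : R) (f : T -> \bar R), (0 <= r)%R ->
  measurable_fun setT f -> (forall x, 0 <= f x) ->
  Phi (fun x => r%:E * f x) = r%:E * Phi f.
Hypothesis Phi_limn : forall f_ : (T -> \bar R)^nat,
  (forall n, measurable_fun setT (f_ n)) -> (forall n x, 0 <= f_ n x) ->
  (forall x, nondecreasing_seq (f_ ^~ x)) ->
  Phi (fun x => limn (f_ ^~ x)) = limn (fun n => Phi (f_ n)).

Import HBNNSimple.

Let Phi_sum (s : seq R) (A : R -> set T) : (forall r, measurable (A r)) ->
  (forall r, r \in s -> 0 <= r)%R ->
  Phi (fun x => \sum_(r <- s) r%:E * (\1_(A r) x)%:E) =
  \sum_(r <- s) r%:E * m (A r).
Proof.
move=> mA; elim: s => [|r s IH] s0.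
  have P0 : Phi (fun=> 0) = 0.
    transitivity (Phi (fun x => 0%:E * cst 0 x)).
      by congr Phi; apply/funext => x; rewrite mul0e.
    rewrite (PhiZ (lexx 0%R) (measurable_cst (0 : \bar R)) (fun=> lexx 0)).
    by rewrite mul0e.
  by rewrite big_nil -[RHS]P0; congr Phi; apply/funext => x; rewrite big_nil.
have r0 : (0 <= r)%R by apply: s0; rewrite mem_head.
have s0' t : t \in s -> (0 <= t)%R by move=> ts; apply: s0; rewrite inE ts orbT.
have mind t : measurable_fun setT (fun x => (\1_(A t) x)%:E : \bar R).
  by apply/measurable_EFinP; exact: measurable_indic.
rewrite big_cons -IH// -Phi_indic// -PhiZ//.
rewrite -PhiD//.
- by congr Phi; apply/funext => x; rewrite big_cons.
- exact: measurable_funeM.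
- by apply: emeasurable_sum => t; exact: measurable_funeM.
- by move=> x; rewrite mule_ge0// lee_fin.
- move=> x; rewrite big_seq sume_ge0// => t /s0' t0.
  by rewrite mule_ge0// lee_fin.
Qed.

Let Phi_nnsfun (f : {nnsfun T >-> R}) :
  Phi (fun x => (f x)%:E) = \int[m]_x (f x)%:E.
Proof.
pose S : seq R := finmap.enum_fset (fset_set (range f)).
have fE x : f x = (\sum_(r <- S) r * \1_(f @^-1` [set r]) x)%R.
  by rewrite fimfunE fsbig_finite.
have s0 r : r \in S -> (0 <= r)%R.
  have -> : (r \in S) = (r \in range f) := in_fset_set (fimfunP f) r.
  by rewrite inE => -[x _ <-].
have mf r : measurable (f @^-1` [set r]) by [].
transitivity (\sum_(r <- S) r%:E * m (f @^-1` [set r])).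
  rewrite -Phi_sum//; congr Phi; apply/funext => x.
  by rewrite fE -sumEFin; apply: eq_bigr => r _; rewrite EFinM.
by rewrite integralT_nnsfun sintegralE fsbig_finite.
Qed.

(** The passage from indicators to simple functions to monotone limits, done once. It serves for
    integration against a density and for iterated integration against a kernel. *)
Lemma integral_functional (f : T -> \bar R) : measurable_fun setT f ->
  (forall x, 0 <= f x) -> Phi f = \int[m]_x f x.
Proof.
move=> mf f0; pose f_ := nnsfun_approx measurableT mf.
have mf_ n : measurable_fun setT (fun x => (f_ n x)%:E).
  exact/measurable_EFinP.
have nd_ x : nondecreasing_seq (fun n => (f_ n x)%:E).
  by move=> a b ab; rewrite lee_fin; exact/lefP/nd_nnsfun_approx.
have fE : f = (fun x => limn (fun n => (f_ n x)%:E)).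
  by apply/funext => x; apply/esym/cvg_lim => //; exact: cvg_nnsfun_approx.
rewrite {1}fE Phi_limn//; last by move=> n x; rewrite lee_fin.
under eq_fun do rewrite Phi_nnsfun.
rewrite -monotone_convergence//.
- by apply: eq_integral => x _; rewrite [in RHS]fE.
- by move=> n x _; rewrite lee_fin.
Qed.

End integral_functional.

Section density.
Context d (T : measurableType d) (R : realType).
Variables (m : {measure set T -> \bar R}) (s : T -> R).
Hypothesis ms : measurable_fun setT s.
Hypothesis s0 : forall x, 0 <= s x.
Local Open Scope ereal_scope.

Lemma integral_density (n : {measure set T -> \bar R}) (f : T -> \bar R) :
  (forall A, measurable A -> n A = \int[m]_(x in A) (s x)%:E) ->
  measurable_fun setT f -> (forall x, 0 <= f x) ->
  \int[n]_x f x = \int[m]_x (f x * (s x)%:E).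
Proof.
move=> nE mf f0; apply/esym.
have ms' : measurable_fun setT (EFin \o s) by exact/measurable_EFinP.
have s0' x : 0 <= (s x)%:E by rewrite lee_fin.
pose Phi (h : T -> \bar R) := \int[m]_x (h x * (s x)%:E).
rewrite -[LHS]/(Phi f).
apply: (@integral_functional _ _ _ n Phi) => //.
- move=> A mA; rewrite nE// [RHS]integral_mkcond; apply: eq_integral => x _.
  rewrite /patch indicE; case: ifPn => _; first by rewrite mul1e.
  by rewrite mul0e.
- move=> h1 h2 mh1 mh2 h10 h20; rewrite /Phi -ge0_integralD//.
  + by apply: eq_integral => x _; rewrite ge0_muleDl.
  + by move=> x _; rewrite mule_ge0.
  + exact: emeasurable_funM.
  + by move=> x _; rewrite mule_ge0.
  + exact: emeasurable_funM.
- move=> r h r0 mh h0; rewrite /Phi -ge0_integralZl//.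
  + by apply: eq_integral => x _; rewrite muleA.
  + exact: emeasurable_funM.
  + by move=> x _; rewrite mule_ge0.
- move=> h_ mh_ h0_ nd; rewrite /Phi -monotone_convergence//.
  + apply: eq_integral => x _; rewrite [LHS]muleC -limeMl//; last first.
    by apply: ereal_nondecreasing_is_cvgn; exact: nd.
    by congr (limn _); apply/funext => k; rewrite muleC.
  + by move=> k; exact: emeasurable_funM.
  + by move=> k x _; rewrite mule_ge0.
  + by move=> x _ a b ab; apply: lee_wpmul2r; [exact: s0'|exact: nd].
Qed.

End density.

(** No integrability is required: since [s] is nonnegative, multiplication by [s] commutes with
    taking positive and negative parts, and these are treated separately. *)
Lemma integral_density_real d (T : measurableType d) (R : realType)
    (m n : {measure set T -> \bar R}) (s f : T -> R) :
  measurable_fun setT s -> (forall x, 0 <= s x) ->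
  (forall A, measurable A -> n A = \int[m]_(x in A) (s x)%:E)%E ->
  measurable_fun setT f ->
  (\int[n]_x (f x)%:E = \int[m]_x (f x * s x)%:E)%E.
Proof.
move=> ms s0 nE mf; rewrite [LHS]integralE [RHS]integralE.
have mf' : measurable_fun setT (EFin \o f) by exact/measurable_EFinP.
congr (_ - _)%E.
  rewrite (integral_density ms s0 nE)//; last exact: measurable_funepos.
  apply: eq_integral => x _; rewrite !funeposE -!EFin_max -EFinM.
  by rewrite maxr_pMl// mul0r.
rewrite (integral_density ms s0 nE)//; last exact: measurable_funeneg.
apply: eq_integral => x _; rewrite !funenegE -!EFinN -!EFin_max -EFinM.
by rewrite maxr_pMl// mul0r mulNr.
Qed.

Section semidirect_lemmas.
Context d d' (W : measurableType d) (Y : measurableType d') (R : realType).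
Variables (Q : probability W R) (k : R.-pker W ~> Y).
Local Open Scope ereal_scope.

Lemma measurable_fun_kernel_integral (h : W * Y -> \bar R) :
  measurable_fun setT h -> (forall z, 0 <= h z) ->
  measurable_fun setT (fun w => \int[k w]_y h (w, y)).
Proof.
move=> mh h0; exact: (measurable_fun_integral_finite_kernel h k).
Qed.

Lemma integral_semidirect (f : W * Y -> \bar R) :
  measurable_fun setT f -> (forall z, 0 <= f z) ->
  \int[semidirect Q k]_z f z = \int[Q]_w \int[k w]_y f (w, y).
Proof.
move=> mf f0; apply/esym.
pose Phi (h : W * Y -> \bar R) := \int[Q]_w \int[k w]_y h (w, y).
rewrite -[LHS]/(Phi f).
have msec (h : W * Y -> \bar R) w : measurable_fun setT h ->
    measurable_fun setT (fun y => h (w, y)).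
  by move=> mh; apply: measurableT_comp => //; exact: measurable_pair1.
apply: (@integral_functional _ _ _ (semidirect Q k) Phi) => //.
- move=> A mA; rewrite /Phi /= /semidirect; apply: eq_integral => w _.
  have -> : (fun y => (\1_A (w, y))%:E : \bar R) =
      (fun y => (\1_(xsection A w) y)%:E).
    apply/funext => y; rewrite !indicE; congr (_ %:E).
    by congr ((nat_of_bool _)%:R); apply/idP/idP; rewrite mem_xsection.
  by rewrite integral_indic ?setIT//; exact: measurable_xsection.
- move=> h1 h2 mh1 mh2 h10 h20; rewrite /Phi -ge0_integralD//.
  + apply: eq_integral => w _; rewrite ge0_integralD//; exact: msec.
  + by move=> w _; exact: integral_ge0.
  + exact: measurable_fun_kernel_integral.
  + by move=> w _; exact: integral_ge0.
  + exact: measurable_fun_kernel_integral.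
- move=> r h r0 mh h0; rewrite /Phi -ge0_integralZl//.
  + apply: eq_integral => w _; rewrite ge0_integralZl//; exact: msec.
  + exact: measurable_fun_kernel_integral.
  + by move=> w _; exact: integral_ge0.
- move=> h_ mh_ h0_ nd; rewrite /Phi -monotone_convergence//.
  + apply: eq_integral => w _; rewrite monotone_convergence//.
    by move=> n; exact: msec.
  + by move=> n; apply: measurable_fun_kernel_integral; [exact: mh_|exact: h0_].
  + by move=> n w _; exact: integral_ge0.
  + move=> w _ a b ab; apply: ge0_le_integral => //; try exact: msec.
    by move=> y _; exact: nd.
Qed.

Lemma ae_semidirect_fst (A : W -> Prop) : {ae Q, forall w, A w} ->
  {ae semidirect Q k, forall z, A z.1}.
Proof.
move=> [N [mN QN NA]]; exists (N `*` setT); split.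
- exact: measurableX.
- rewrite /= /semidirect (eq_integral (fun w => (\1_N w)%:E)) => [|w _].
    by rewrite integral_indic// setIT.
  rewrite indicE; case: (boolP (w \in N)) => wN.
    by rewrite in_xsectionX ?prob_kernel.
  by rewrite notin_xsectionX ?measure0.
- by move=> [w y] /= nA; split => //; exact: NA.
Qed.

End semidirect_lemmas.

Lemma measure_unique_rect d1 d2 (T1 : measurableType d1)
    (T2 : measurableType d2) (R : realType)
    (m1 m2 : {finite_measure set (T1 * T2)%type -> \bar R}) :
  (forall A B, measurable A -> measurable B -> m1 (A `*` B) = m2 (A `*` B)) ->
  forall X, measurable X -> m1 X = m2 X.
Proof.
move=> m12 X mX.
pose C : set (set (T1 * T2)) :=
  [set A `*` B | A in measurable & B in measurable].
apply: (measure_unique C (fun=> setT)) => //.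
- by rewrite measurable_prod_measurableType.
- move=> _ _ [A mA [B mB <-]] [A' mA' [B' mB' <-]]; rewrite -setXI.
  exists (A `&` A'); first exact: measurableI.
  by exists (B `&` B') => //; exact: measurableI.
- by move=> _; exists setT => //; exists setT => //; rewrite setXTT.
- by apply/seteqP; split => // x _; exists 0%N.
- by move=> _ [A mA [B mB <-]]; exact: m12.
- by move=> _; rewrite ltey_eq fin_num_measure.
Qed.

(** * Finite transport problems *)

Lemma continuous_sum (T : topologicalType) (R : realType) (I : Type)
    (s : seq I) (f : I -> T -> R) : (forall i, continuous (f i)) ->
  continuous (fun x => \sum_(i <- s) f i x).
Proof.
move=> cf; elim: s => [|i s IH].
  under eq_fun do rewrite big_nil.
  by move=> x; exact: cst_continuous.
under eq_fun do rewrite big_cons.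
by move=> x; apply: cvgD; [exact: cf|exact: IH].
Qed.

Section finite_duality.
Context (R : realType) (N : nat).
Notation I := 'I_N.+1.
Variables (d : I -> I -> R).
Hypothesis d_ge0 : forall i j, 0 <= d i j.

Definition rowsum (q : I -> I -> R) i := \sum_j q i j.
Definition colsum (q : I -> I -> R) j := \sum_i q i j.
Definition plan_cost (q : I -> I -> R) := \sum_i \sum_j d i j * q i j.

Lemma sum_sq_update (x : I -> R) (t : R) (i0 : I) :
  \sum_i (x i + t * (i == i0)%:R) ^+ 2 =
  \sum_i (x i) ^+ 2 + 2 * t * x i0 + t ^+ 2.
Proof.
rewrite (bigD1 i0)//= [in RHS](bigD1 i0)//= eqxx mulr1.
under eq_bigr => i /negbTE -> do rewrite mulr0 addr0.
by ring.
Qed.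

Section penalised.
Variables (m n : I -> R) (e : R).
Hypothesis e0 : 0 < e.
Hypothesis m_ge0 : forall i, 0 <= m i.
Hypothesis n_ge0 : forall i, 0 <= n i.
Hypothesis m_sum : \sum_i m i = 1.
Hypothesis n_sum : \sum_i n i = 1.

(** The factor [1 / (2 * e)] makes the derivative of the penalty with respect to a marginal equal to
    its defect divided by [e], which is a dual variable up to sign. *)
Definition penalised_cost (q : I -> I -> R) : R :=
  plan_cost q + (\sum_i (rowsum q i - m i) ^+ 2 +
                 \sum_j (colsum q j - n j) ^+ 2) / (2 * e).

Let m_le1 i : m i <= 1.
Proof. by rewrite -m_sum (bigD1 i)//= lerDl sumr_ge0. Qed.

Let n_le1 i : n i <= 1.
Proof. by rewrite -n_sum (bigD1 i)//= lerDl sumr_ge0. Qed.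

Lemma penalised_min : exists q : I -> I -> R,
  (forall i j, 0 <= q i j <= 2) /\
  forall q', (forall i j, 0 <= q' i j <= 2) ->
    penalised_cost q <= penalised_cost q'.
Proof.
(* Flattened into a row vector, the matrices with entries in [[0, 2]] form a product of segments,
   hence a compact set. *)
pose V := 'rV[R]_#|{: I * I}|.
pose fn (v : V) i j := v ord0 (enum_rank (i, j)).
pose A : set V := [set v | forall k, `[0, 2]%classic (v ord0 k)].
have cA : compact A.
  exact: (rV_compact (fun=> @segment_compact R 0 2)).
have cf i j : continuous (fun v : V => fn v i j).
  by move=> v; exact: coord_continuous.
have cX (f : V -> R) : continuous f -> continuous (fun v => f v ^+ 2).
  move=> cf' v; have -> : (fun v => f v ^+ 2) = (fun v => f v * f v).
    by apply/funext => w; rewrite expr2.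
  exact: (continuousM (cf' v) (cf' v)).
have cF : continuous (fun v => penalised_cost (fn v)).
  have cB (f : V -> R) (c : R) : continuous f -> continuous (fun v => f v - c).
    by move=> cf' v; exact: (continuousB (cf' v) (@cst_continuous _ _ c v)).
  have cc (f : V -> R) (c : R) : continuous f -> continuous (fun v => c * f v).
    by move=> cf' v; exact: (continuousM (@cst_continuous _ _ c v) (cf' v)).
  have cD (f h : V -> R) : continuous f -> continuous h ->
      continuous (fun v => f v + h v).
    by move=> cf' ch v; exact: (continuousD (cf' v) (ch v)).
  apply: (cD _ _).
    by apply: continuous_sum => i; apply: continuous_sum => j; exact: cc.
  under eq_fun do rewrite mulrC.
  by apply: cc; apply: cD; apply: continuous_sum => i; apply/cX/cB;
    apply: continuous_sum => j; exact: cf.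
have A0 : A !=set0.
  by exists 0 => k; rewrite /= mxE in_itv/= lexx ler0n.
have [v + vmin] := @compact_EVT_min _ _ _ _ A0 cA (continuous_subspaceT cF).
rewrite inE => vA; exists (fn v); split => [i j|q' q'2].
  by have := vA (enum_rank (i, j)); rewrite /= in_itv.
have := vmin (\row_k q' (enum_val k).1 (enum_val k).2); rewrite inE.
have -> : fn (\row_k q' (enum_val k).1 (enum_val k).2) = q'.
  by apply/funext => i; apply/funext => j; rewrite /fn mxE enum_rankK.
by apply => k; rewrite /= mxE in_itv/=; exact: q'2.
Qed.

(* The Kuhn-Tucker conditions of the penalised problem: the rescaled defects
   [a], [b] of the marginals are dual variables. *)
Lemma penalised_dual (D : R) : (forall i j, d i j <= D) ->
  exists q a b, [/\ (forall i j, 0 <= q i j),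
    (forall i j, a i + b j <= d i j),
    plan_cost q = \sum_i a i * rowsum q i + \sum_j b j * colsum q j,
    (forall i, rowsum q i = m i - e * a i) /\
    (forall j, colsum q j = n j - e * b j) &
    e * (\sum_i a i ^+ 2 + \sum_j b j ^+ 2) <= 2 * D].
Proof.
move=> dD; have [q [q02 qmin]] := penalised_min.
pose a i := (m i - rowsum q i) / e; pose b j := (n j - colsum q j) / e.
have e_neq0 : e != 0 by rewrite gt_eqF.
have rowE i : rowsum q i = m i - e * a i by rewrite /a; field.
have colE j : colsum q j = n j - e * b j by rewrite /b; field.
have q_ge0 i j : 0 <= q i j by have /andP[] := q02 i j.
pose up i0 j0 (t : R) i j := q i j + t * ((i == i0) && (j == j0))%:R.
(* An exact expansion: one row sum and one column sum move by [t], and each contributes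
   [t ^+ 2 / (2 * e)]. *)
have upF i0 j0 t : penalised_cost (up i0 j0 t) = penalised_cost q +
    t * (d i0 j0 - a i0 - b j0) + t ^+ 2 / e.
  have rowU i : rowsum (up i0 j0 t) i = rowsum q i + t * (i == i0)%:R.
    rewrite /rowsum big_split/=; congr (_ + _).
    rewrite (bigD1 j0)//= eqxx andbT big1 ?addr0// => j /negbTE ->.
    by rewrite andbF mulr0.
  have colU j : colsum (up i0 j0 t) j = colsum q j + t * (j == j0)%:R.
    rewrite /colsum big_split/=; congr (_ + _).
    rewrite (bigD1 i0)//= eqxx andTb big1 ?addr0// => i /negbTE ->.
    by rewrite mulr0.
  have costU : plan_cost (up i0 j0 t) = plan_cost q + t * d i0 j0.
    rewrite /plan_cost (bigD1 i0)//= [in RHS](bigD1 i0)//=.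
    rewrite (bigD1 j0)//= [in RHS](bigD1 j0)//= {1}/up !eqxx/= mulr1.
    have -> : \sum_(j < N.+1 | j != j0) d i0 j * up i0 j0 t i0 j =
        \sum_(j < N.+1 | j != j0) d i0 j * q i0 j.
      by apply: eq_bigr => j /negbTE jj0; rewrite /up jj0 andbF mulr0 addr0.
    have -> : \sum_(i < N.+1 | i != i0) \sum_(j < N.+1) d i j * up i0 j0 t i j =
        \sum_(i < N.+1 | i != i0) \sum_(j < N.+1) d i j * q i j.
      apply: eq_bigr => i /negbTE ii0; apply: eq_bigr => j _.
      by rewrite /up ii0/= mulr0 addr0.
    by ring.
  rewrite /penalised_cost costU.
  under eq_bigr do rewrite rowU addrAC.
  under [X in _ + (_ + X) / _]eq_bigr do rewrite colU addrAC.
  rewrite !sum_sq_update /a /b; field; exact: e_neq0.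
have up02 i0 j0 t : 0 <= q i0 j0 + t <= 2 ->
    forall i j, 0 <= up i0 j0 t i j <= 2.
  move=> t02 i j; rewrite /up; case: eqP => [->|_]; last first.
    by rewrite mulr0 addr0.
  case: eqP => [->|_]; first by rewrite mulr1.
  by rewrite mulr0 addr0.
have slope i0 j0 t : 0 <= q i0 j0 + t <= 2 ->
    0 <= t * (d i0 j0 - a i0 - b j0) + t ^+ 2 / e.
  by move=> /up02/qmin; rewrite upF -addrA lerDl.
have le_ab i j : a i + b j <= d i j.
  (* An entry on the upper face of the box cannot be increased. But then its row and column sums are
     at least 2 while the masses are at most 1, so [a i] and [b j] are nonpositive and the
     inequality is trivial. *)
  have [q2|q2] := ltP (q i j) 2; last first.
    have r2 : 2 <= rowsum q i.
      by rewrite /rowsum (bigD1 j)//= (le_trans q2)// lerDl sumr_ge0.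
    have c2 : 2 <= colsum q j.
      by rewrite /colsum (bigD1 i)//= (le_trans q2)// lerDl sumr_ge0.
    have a0 : a i <= 0.
      by rewrite /a pmulr_lle0 ?invr_gt0//; have := m_le1 i; lra.
    have b0 : b j <= 0.
      by rewrite /b pmulr_lle0 ?invr_gt0//; have := n_le1 j; lra.
    by have := d_ge0 i j; lra.
  rewrite leNgt; apply/negP => abd.
  pose s := a i + b j - d i j.
  have s0 : 0 < s by rewrite subr_gt0.
  (* The cost changes by [t * (t / e - s)], which is negative for [0 < t < e * s]. The witness is
     half of that bound, capped by the room left in the box. *)
  pose t := Num.min (2 - q i j) (e * s / 2).
  have t0 : 0 < t by rewrite /t lt_min subr_gt0 q2 divr_gt0// mulr_gt0.
  have t1 : t <= 2 - q i j by rewrite /t ge_min lexx.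
  have t2 : t <= e * s / 2 by rewrite /t ge_min lexx orbT.
  have /slope : 0 <= q i j + t <= 2 by have := q_ge0 i j; lra.
  have -> : t * (d i j - a i - b j) + t ^+ 2 / e = t * (t / e - s).
    by rewrite /s; ring.
  rewrite pmulr_rge0// subr_ge0 leNgt => /negP; apply.
  rewrite ltr_pdivrMr// (le_lt_trans t2)// ltr_pdivrMr// mulrC.
  by have := mulr_gt0 s0 e0; lra.
(* Complementary slackness: a positive entry can also be decreased, which gives the reverse
   inequality. *)
have eq_ab i j : d i j * q i j = a i * q i j + b j * q i j.
  have [->|qn0] := eqVneq (q i j) 0; first by rewrite !mulr0 addr0.
  have qp : 0 < q i j by rewrite lt_neqAle eq_sym qn0 q_ge0.
  rewrite -mulrDl; congr (_ * _); apply/eqP; rewrite eq_le le_ab andbT.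
  rewrite leNgt; apply/negP => abd.
  pose s := d i j - (a i + b j).
  have s0 : 0 < s by rewrite subr_gt0.
  pose t := Num.min (q i j) (e * s / 2).
  have t0 : 0 < t by rewrite /t lt_min qp divr_gt0// mulr_gt0.
  have t1 : t <= q i j by rewrite /t ge_min lexx.
  have t2 : t <= e * s / 2 by rewrite /t ge_min lexx orbT.
  have /slope : 0 <= q i j + - t <= 2 by have /andP[] := q02 i j; lra.
  have -> : - t * (d i j - a i - b j) + (- t) ^+ 2 / e = t * (t / e - s).
    by rewrite /s; ring.
  rewrite pmulr_rge0// subr_ge0 leNgt => /negP; apply.
  rewrite ltr_pdivrMr// (le_lt_trans t2)// ltr_pdivrMr// mulrC.
  by have := mulr_gt0 s0 e0; lra.
exists q, a, b; split => //.
  rewrite /plan_cost.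
  under eq_bigr do under eq_bigr do rewrite eq_ab.
  under eq_bigr do rewrite big_split/=.
  rewrite big_split/=; congr (_ + _).
    by apply: eq_bigr => i _; rewrite /rowsum mulr_sumr.
  by rewrite exchange_big/=; apply: eq_bigr => j _; rewrite /colsum mulr_sumr.
(* The product plan is the competitor: it pays no penalty and costs at most [D], which bounds the
   penalty at the minimiser and thus the squares of [a] and [b]. *)
have mn02 i j : 0 <= m i * n j <= 2.
  rewrite mulr_ge0//= (le_trans (ler_pM _ _ (m_le1 i) (n_le1 j)))//.
  by rewrite mulr1 ler1n.
have := qmin _ mn02.
have -> : penalised_cost (fun i j => m i * n j) =
    plan_cost (fun i j => m i * n j).
  rewrite /penalised_cost big1 => [|i _]; last first.
    by rewrite /rowsum -mulr_sumr n_sum mulr1 subrr expr0n.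
  rewrite big1 => [|i _]; first by rewrite addr0 mul0r addr0.
  by rewrite /colsum -mulr_suml m_sum mul1r subrr expr0n.
have c1 : plan_cost (fun i j => m i * n j) <= D.
  have -> : D = \sum_i \sum_j D * (m i * n j).
    under eq_bigr do rewrite -mulr_sumr -mulr_sumr n_sum mulr1.
    by rewrite -mulr_sumr m_sum mulr1.
  by apply: ler_sum => i _; apply: ler_sum => j _; rewrite ler_wpM2r// mulr_ge0.
have c0 : 0 <= plan_cost q.
  by apply: sumr_ge0 => i _; apply: sumr_ge0 => j _; rewrite mulr_ge0.
rewrite /penalised_cost.
have -> : (\sum_i (rowsum q i - m i) ^+ 2 + \sum_j (colsum q j - n j) ^+ 2) /
    (2 * e) = e * (\sum_i a i ^+ 2 + \sum_j b j ^+ 2) / 2.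
  under eq_bigr do rewrite rowE addrAC subrr add0r sqrrN exprMn.
  under [X in _ + X]eq_bigr do rewrite colE addrAC subrr add0r sqrrN exprMn.
  by rewrite -!mulr_sumr; field.
lra.
Qed.

End penalised.
End finite_duality.

(** * Feasible near-optimal plans on a grid *)

Section finite_plan.
Context (R : realType) (N : nat).
Notation I := 'I_N.+1.

(** Row [i] is scaled by [la i] and column [j] by [mu j], each factor being just small enough to
    respect its bound. Row scaling, column scaling and the initial deficit of [q] each lose at most
    [N.+1%:R * eta]. *)
Lemma trim_plan (q : I -> I -> R) (m n : I -> R) (eta : R) :
  (forall i j, 0 <= q i j) -> (forall i, 0 <= m i) -> (forall j, 0 <= n j) ->
  \sum_i m i = 1 ->
  (forall i, `|rowsum q i - m i| <= eta) ->
  (forall j, `|colsum q j - n j| <= eta) ->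
  exists r : I -> I -> R, [/\ (forall i j, 0 <= r i j <= q i j),
    (forall i, rowsum r i <= m i), (forall j, colsum r j <= n j) &
    1 - 3 * N.+1%:R * eta <= \sum_i rowsum r i].
Proof.
move=> q0 m0 n0 m1 rowE colE.
have eta0 : 0 <= eta by exact: le_trans (rowE ord0).
have factor (x y : R) : 0 <= x -> 0 <= y -> `|x - y| <= eta ->
    exists l : R, [/\ 0 <= l <= 1, l * x <= y & x * (1 - l) <= eta].
  move=> x0 y0; rewrite ler_norml => /andP[xy1 xy2].
  have [xy|yx] := leP x y.
    by exists 1; rewrite ler01 lexx mul1r subrr mulr0.
  have xp : 0 < x by exact: le_lt_trans yx.
  exists (y / x); rewrite divr_ge0//= ler_pdivrMr// mul1r (ltW yx).
  rewrite divfK ?gt_eqF// lexx; split => //.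
  by rewrite mulrBr mulr1 mulrC divfK ?gt_eqF.
have row0 i : 0 <= rowsum q i by exact: sumr_ge0.
have col0 j : 0 <= colsum q j by exact: sumr_ge0.
have [la la_prop] := choice (fun i => factor _ _ (row0 i) (m0 i) (rowE i)).
have [mu mu_prop] := choice (fun j => factor _ _ (col0 j) (n0 j) (colE j)).
have la01 i : 0 <= la i <= 1 by have [] := la_prop i.
have mu01 j : 0 <= mu j <= 1 by have [] := mu_prop j.
exists (fun i j => q i j * (la i * mu j)).
have lamu i j : 0 <= la i * mu j <= 1.
  have /andP[l0 l1] := la01 i; have /andP[k0 k1] := mu01 j.
  by rewrite mulr_ge0//= mulr_ile1.
split => [i j|i|j|].
- by have /andP[? ?] := lamu i j; rewrite mulr_ge0//= ler_piMr.
- have [_ + _] := la_prop i; apply: le_trans.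
  rewrite /rowsum mulr_sumr; apply: ler_sum => j _.
  have /andP[l0 l1] := la01 i; have /andP[k0 k1] := mu01 j.
  by rewrite mulrC ler_wpM2r// ler_piMr.
- have [_ + _] := mu_prop j; apply: le_trans.
  rewrite /colsum mulr_sumr; apply: ler_sum => i _.
  have /andP[l0 l1] := la01 i; have /andP[k0 k1] := mu01 j.
  by rewrite mulrC ler_wpM2r// ler_piMl.
have card : \sum_(i < N.+1) eta = N.+1%:R * eta.
  by rewrite sumr_const card_ord mulr_natl.
have lossr : \sum_i rowsum q i * (1 - la i) <= N.+1%:R * eta.
  by rewrite -card; apply: ler_sum => i _; have [] := la_prop i.
have lossc : \sum_j colsum q j * (1 - mu j) <= N.+1%:R * eta.
  by rewrite -card; apply: ler_sum => i _; have [] := mu_prop i.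
have mass : 1 - N.+1%:R * eta <= \sum_i rowsum q i.
  rewrite -card -m1 -sumrB; apply: ler_sum => i _.
  by have := rowE i; rewrite ler_norml => /andP[]; lra.
(* Entrywise this is [1 <= la i * mu j + (1 - la i) + (1 - mu j)], that is
   [0 <= (1 - la i) * (1 - mu j)]. *)
have : \sum_i rowsum q i <= \sum_i rowsum (fun i j => q i j * (la i * mu j)) i
    + \sum_i rowsum q i * (1 - la i) + \sum_j colsum q j * (1 - mu j).
  have -> : \sum_j colsum q j * (1 - mu j) = \sum_i \sum_j q i j * (1 - mu j).
    by rewrite exchange_big/=; apply: eq_bigr => j _; rewrite mulr_suml.
  rewrite -!big_split/=; apply: ler_sum => i _.
  rewrite /rowsum mulr_suml -!big_split/=; apply: ler_sum => j _.
  rewrite -!mulrDr ler_peMr//.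
  have /andP[l0 l1] := la01 i; have /andP[k0 k1] := mu01 j.
  have : 0 <= (1 - la i) * (1 - mu j) by rewrite mulr_ge0 ?subr_ge0.
  by lra.
by lra.
Qed.

(** The inf-convolution of [v] with the distance, known as its c-transform. The default value is
    itself one of the terms, so it does not change the minimum. *)
Definition minext (v dist : I -> R) : R :=
  \big[Num.min/v ord0 + dist ord0]_j (v j + dist j).

Lemma minext_le (v dist : I -> R) j : minext v dist <= v j + dist j.
Proof. exact: bigmin_le. Qed.

Lemma le_minext (v dist : I -> R) a :
  (forall j, a <= v j + dist j) -> a <= minext v dist.
Proof. by move=> av; apply/bigmin_geP; split => [|j _]; exact: av. Qed.

Lemma minext_shift (v dist v' dist' : I -> R) c :
  (forall j, v j + dist j <= v' j + dist' j + c) ->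
  minext v dist <= minext v' dist' + c.
Proof.
move=> vv'; rewrite -lerBlDr; apply: le_minext => j.
by rewrite lerBlDr (le_trans (minext_le v dist j)).
Qed.

Definition mass (q : I -> I -> R) := \sum_i rowsum q i.

Variable d : I -> I -> R.
Hypothesis d_ge0 : forall i j, 0 <= d i j.
Hypothesis d_refl : forall i, d i i = 0.

(** For fixed [q] and [v] these are finitely many inequalities in the marginals, so they cut out a
    measurable set of [w]. The mass is strictly below one because [completion] divides by the
    missing mass. *)
Definition near_optimal (delta : R) (m n : I -> R) (q : I -> I -> R)
    (v : I -> R) : Prop :=
  [/\ (forall i, rowsum q i <= m i), (forall j, colsum q j <= n j),
    1 - delta <= mass q, mass q < 1 &
    plan_cost d q <= \sum_i minext v (d i) * (m i - n i) + delta].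

(** The point is the order of quantifiers: the step [1 / K] is chosen before the marginals, hence
    uniformly in [w]. *)
Lemma grid_near_optimal (D delta : R) : (forall i j, d i j <= D) ->
  0 < delta < 1 -> exists2 K : nat, (0 < K)%N &
  forall m n : I -> R, (forall i, 0 <= m i) -> (forall j, 0 <= n j) ->
    \sum_i m i = 1 -> \sum_j n j = 1 ->
    exists (A : I -> I -> nat) (B : I -> int),
      near_optimal delta m n (fun i j => (A i j)%:R / K%:R)
                             (fun j => (B j)%:~R / K%:R).
Proof.
move=> dD /andP[delta0 delta1].
have D0 : 0 <= D by rewrite -(d_refl ord0).
have N0 : 0 < N.+1%:R :> R by rewrite ltr0n.
have N1 : 1 <= N.+1%:R :> R by rewrite ler1n.
(* With this value trimming loses [3 * N.+1%:R * eta = delta / 4]. *)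
pose eta := delta / (12 * N.+1%:R).
have eta0 : 0 < eta by rewrite divr_gt0// mulr_gt0.
(* Then [e * (2 * D) <= eta ^+ 2], so the bound of [penalised_dual] makes every defect [e * a i] and
   [e * b j] at most [eta]. Using [D + 1] keeps the denominator positive when [D = 0]. *)
pose e := eta ^+ 2 / (2 * (D + 1)).
have D1 : 0 < D + 1 by lra.
have e0 : 0 < e by rewrite divr_gt0 ?exprn_gt0// mulr_gt0.
(* For [K] above [x], rounding [N.+1 ^ 2] entries down to multiples of [1 / K] loses at most
   [delta / 2] of mass. *)
pose x := 2 * N.+1%:R ^+ 2 / delta.
have x0 : 0 <= x by rewrite divr_ge0 ?mulr_ge0 ?exprn_ge0 ?ltW.
have [K K_gt0 xK] : exists2 K : nat, (0 < K)%N & x < K%:R.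
  by exists (Num.truncn x).+1 => //; have /andP[] := truncn_itv x0.
have K0 : 0 < K%:R :> R by rewrite ltr0n.
have Kdelta : N.+1%:R ^+ 2 / K%:R <= delta / 2.
  rewrite ler_pdivrMr//; move: xK; rewrite /x ltr_pdivrMr//; lra.
have Kdelta1 : 1 / K%:R <= delta / 2.
  apply: le_trans Kdelta; rewrite ler_pM2r ?invr_gt0//.
  by rewrite exprn_ege1.
exists K => // m n m0 n0 m1 n1.
have [q [a [b [q0 ab qcost [rowE colE] ab2]]]] :=
  penalised_dual d_ge0 e0 m0 n0 m1 n1 dD.
have small (z s : R) : 0 <= s -> e * (z ^+ 2 + s) <= 2 * D -> `|e * z| <= eta.
  move=> s0 zs; rewrite -(ler_pXn2r (_ : (0 < 2)%N)) ?nnegrE// ?(ltW eta0)//.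
  rewrite -normrX ger0_norm ?sqr_ge0// exprMn.
  have : e * (e * z ^+ 2) <= e * (2 * D).
    rewrite ler_pM2l// (le_trans _ zs)// ler_pM2l//; lra.
  have -> : e * (2 * D) = eta ^+ 2 * (D / (D + 1)).
    by rewrite /e; field; rewrite gt_eqF.
  rewrite mulrA -expr2 => /le_trans; apply.
  by rewrite ler_piMr ?exprn_ge0 ?ltW// ltr_pdivrMr// mul1r; lra.
have rowS i : `|rowsum q i - m i| <= eta.
  rewrite rowE addrAC subrr add0r normrN.
  apply: (small _ (\sum_(i' | i' != i) a i' ^+ 2 + \sum_j b j ^+ 2)).
    by rewrite addr_ge0 ?sumr_ge0// => ? _; rewrite sqr_ge0.
  by move: ab2; rewrite (bigD1 i)//= addrA.
have colS j : `|colsum q j - n j| <= eta.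
  rewrite colE addrAC subrr add0r normrN.
  apply: (small _ (\sum_i a i ^+ 2 + \sum_(j' | j' != j) b j' ^+ 2)).
    by rewrite addr_ge0 ?sumr_ge0// => ? _; rewrite sqr_ge0.
  by move: ab2; rewrite [X in _ * (_ + X) <= _](bigD1 j)//= addrCA.
have [r [r0q rrow rcol rmass]] := trim_plan q0 m0 n0 m1 rowS colS.
(* Shrinking by [t] makes the mass strictly less than one. After trimming and shrinking at least
   [(1 - delta / 4) ^+ 2 >= 1 - delta / 2] is left, and rounding may use up the other half of
   [delta]. *)
pose t := 1 - delta / 4.
have t01 : 0 < t < 1 by rewrite /t; lra.
have /andP[t0 t1] := t01.
have r0 i j : 0 <= r i j by have /andP[] := r0q i j.
have rq i j : r i j <= q i j by have /andP[] := r0q i j.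
pose z i j := K%:R * (t * r i j).
have z0 i j : 0 <= z i j by rewrite !mulr_ge0// ltW.
(* Rounding down keeps the plan below [r], hence below [q], so the bounds on marginals and cost
   survive. The potential approximates [- b], also from below. *)
pose A i j := Num.truncn (z i j).
pose B j := Num.floor (K%:R * - b j).
exists A, B.
pose s i j : R := (A i j)%:R / K%:R.
pose v j : R := (B j)%:~R / K%:R.
rewrite -/s -/v.
have sle i j : s i j <= t * r i j.
  rewrite ler_pdivrMr// [leRHS]mulrC.
  by have /andP[] := truncn_itv (z0 i j).
have sge i j : t * r i j <= s i j + 1 / K%:R.
  rewrite -mulrDl ler_pdivlMr// [leLHS]mulrC natr1.
  by have /andP[_ /ltW] := truncn_itv (z0 i j).
have s0 i j : 0 <= s i j by rewrite divr_ge0.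
have sr i j : s i j <= r i j by rewrite (le_trans (sle i j))// ler_piMl// ltW.
have vle j : v j <= - b j.
  rewrite ler_pdivrMr// mulrC.
  by have /andP[] := floor_itv (K%:R * - b j).
have vge j : - b j <= v j + 1 / K%:R.
  rewrite -mulrDl ler_pdivlMr// mulrC.
  by have /andP[_ /ltW] := floor_itv (K%:R * - b j); rewrite intrD.
have massr : mass r <= 1 by rewrite -m1; apply: ler_sum => i _.
have massr0 : 0 <= mass r.
  by apply: sumr_ge0 => i _; apply: sumr_ge0 => j _.
have mass_t : \sum_i \sum_j t * r i j = t * mass r.
  by rewrite mulr_sumr; apply: eq_bigr => i _; rewrite mulr_sumr.
split => [i|j|||].
- by apply: le_trans (rrow i); apply: ler_sum => j _.
- by apply: le_trans (rcol j); apply: ler_sum => i _.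
- have : t * mass r <= mass s + N.+1%:R ^+ 2 / K%:R.
    have -> : N.+1%:R ^+ 2 / K%:R =
        \sum_(i < N.+1) \sum_(j < N.+1) (1 / K%:R : R).
      rewrite !sumr_const !card_ord -mulrnA -[RHS]mulr_natl natrM.
      by rewrite expr2 mul1r.
    rewrite -mass_t -big_split/=; apply: ler_sum => i _.
    by rewrite -big_split/=; apply: ler_sum => j _; exact: sge.
  have : 1 - delta / 4 <= mass r.
    apply: le_trans rmass; rewrite /eta lerD2l lerN2.
    have cancel (X : R) : X != 0 -> 3 * X * (delta / (12 * X)) = delta / 4.
      by move=> X0; field.
    by rewrite cancel ?gt_eqF.
  move=> mr; have : t * (1 - delta / 4) <= t * mass r by rewrite ler_pM2l.
  rewrite /t; have : 0 <= delta ^+ 2 by rewrite sqr_ge0.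
  by lra.
- apply: le_lt_trans (_ : t * mass r < 1).
    by rewrite -mass_t; apply: ler_sum => i _; apply: ler_sum => j _.
  apply: le_lt_trans (_ : t * 1 < 1); first by rewrite ler_pM2l.
  by rewrite mulr1.
- have -> : \sum_i minext v (d i) * (m i - n i) =
      \sum_i minext v (d i) * m i - \sum_i minext v (d i) * n i.
    by rewrite -sumrB; apply: eq_bigr => i _; rewrite mulrBr.
  (* Dual feasibility gives [d i j + v j >= a i - 1 / K%:R] for all [j]. In the other direction,
     [fn] takes the term [j = i], where the distance vanishes. *)
  have fm : \sum_i (a i - 1 / K%:R) * m i <= \sum_i minext v (d i) * m i.
    apply: ler_sum => i _; rewrite ler_wpM2r//; apply: le_minext => j.
    by have := ab i j; have := vge j; lra.
  have fn : \sum_i minext v (d i) * n i <= \sum_i - b i * n i.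
    apply: ler_sum => i _; rewrite ler_wpM2r//.
    by rewrite (le_trans (minext_le _ _ i))// d_refl addr0.
  have cs : plan_cost d s <= plan_cost d q.
    apply: ler_sum => i _; apply: ler_sum => j _; rewrite ler_wpM2l//.
    exact: le_trans (sr i j) (rq i j).
  (* Replacing the marginals of [q] by [m] and [n] adds the terms [e * a i ^+ 2] and [e * b j ^+ 2],
     which have the favourable sign. *)
  have qc : plan_cost d q <= \sum_i a i * m i + \sum_j b j * n j.
    rewrite qcost lerD//; apply: ler_sum => i _.
      rewrite rowE mulrBr gerBl mulrCA mulr_ge0 ?(ltW e0)// -expr2 sqr_ge0//.
    by rewrite colE mulrBr gerBl mulrCA mulr_ge0 ?(ltW e0)// -expr2 sqr_ge0.
  move: fm fn; under eq_bigr do rewrite mulrBl.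
  rewrite sumrB -mulr_sumr m1 => fm; under [X in _ <= X]eq_bigr do rewrite mulNr.
  rewrite sumrN => fn.
  by lra.
Qed.

End finite_plan.

(** * The outcome space *)

Section eucl_dist.
Context (R : realType) (p : nat).
Implicit Types x y z : 'rV[R]_p.

(** Lagrange's identity: twice the gap is a double sum of squares. *)
Lemma cauchy_schwarz_sum (a b : 'I_p -> R) :
  (\sum_i a i * b i) ^+ 2 <= (\sum_i a i ^+ 2) * (\sum_i b i ^+ 2).
Proof.
have : 0 <= \sum_i \sum_j (a i * b j - a j * b i) ^+ 2.
  by apply: sumr_ge0 => i _; apply: sumr_ge0 => j _; exact: sqr_ge0.
suff -> : \sum_i \sum_j (a i * b j - a j * b i) ^+ 2 =
    2 * ((\sum_i a i ^+ 2) * (\sum_i b i ^+ 2) - (\sum_i a i * b i) ^+ 2).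
  by rewrite pmulr_rge0// subr_ge0.
have prodE (f h : 'I_p -> R) :
    (\sum_i f i) * (\sum_j h j) = \sum_i \sum_j f i * h j.
  by rewrite mulr_suml; apply: eq_bigr => i _; rewrite mulr_sumr.
rewrite expr2 !prodE.
have sw : \sum_i \sum_j a i ^+ 2 * b j ^+ 2 =
    \sum_i \sum_j a j ^+ 2 * b i ^+ 2 by exact: exchange_big.
transitivity (\sum_i \sum_j a i ^+ 2 * b j ^+ 2 +
    \sum_i \sum_j a j ^+ 2 * b i ^+ 2 -
    2 * \sum_i \sum_j a i * b i * (a j * b j)); last by rewrite -sw; ring.
rewrite mulr_sumr -big_split -sumrB/=; apply: eq_bigr => i _.
rewrite mulr_sumr -big_split -sumrB/=; apply: eq_bigr => j _.
by ring.
Qed.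

Lemma eucl_dist_ge0 x y : 0 <= eucl_dist x y.
Proof. exact: sqrtr_ge0. Qed.

Lemma eucl_distxx x : eucl_dist x x = 0.
Proof.
by rewrite /eucl_dist big1 ?sqrtr0// => i _; rewrite subrr expr0n.
Qed.

Lemma eucl_distC x y : eucl_dist x y = eucl_dist y x.
Proof.
by congr Num.sqrt; apply: eq_bigr => i _; rewrite -sqrrN opprB.
Qed.

Lemma eucl_dist_triangle x y z :
  eucl_dist x z <= eucl_dist x y + eucl_dist y z.
Proof.
rewrite -(ler_pXn2r (_ : (0 < 2)%N)) ?nnegrE ?addr_ge0 ?eucl_dist_ge0//.
pose a i := x ord0 i - y ord0 i; pose b i := y ord0 i - z ord0 i.
have sq0 (f : 'I_p -> R) : 0 <= \sum_i f i ^+ 2.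
  by apply: sumr_ge0 => i _; exact: sqr_ge0.
rewrite sqrrD !sqr_sqrtr//.
have -> : \sum_i (x ord0 i - z ord0 i) ^+ 2 =
    \sum_i a i ^+ 2 + (\sum_i a i * b i) *+ 2 + \sum_i b i ^+ 2.
  rewrite -mulr_natl mulr_sumr -!big_split/=; apply: eq_bigr => i _.
  by rewrite /a /b; ring.
rewrite lerD2r lerD2l lerMn2r/= -sqrtrM ?sq0//.
rewrite (le_trans (ler_norm _))// -sqrtr_sqr ler_wsqrtr//.
exact: cauchy_schwarz_sum.
Qed.

Lemma eucl_dist_continuous y : continuous (fun x => eucl_dist x y).
Proof.
move=> x; rewrite /eucl_dist.
apply: (@continuous_comp _ _ _ (fun x => \sum_i (x ord0 i - y ord0 i) ^+ 2)
  (@Num.sqrt R)); last exact: sqrt_continuous.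
move: x; apply: continuous_sum => i x.
have -> : (fun x => (x ord0 i - y ord0 i) ^+ 2) =
   (fun x => (x ord0 i - y ord0 i) * (x ord0 i - y ord0 i)).
  by apply/funext => z; rewrite expr2.
have c1 : {for x, continuous (fun x : 'rV[R]_p => x ord0 i - y ord0 i)}.
  exact: (continuousB (@coord_continuous R 1 p ord0 i x)
    (@cst_continuous _ _ (y ord0 i) x)).
exact: (continuousM c1 c1).
Qed.

End eucl_dist.

Section outcome_space.
Context (R : realType) (p : nat) (Yset : set 'rV[R]_p) (y0 : set_type Yset).
Notation Y := (borel_sub y0).

Definition distY (y y' : Y) : R := eucl_dist (set_val y) (set_val y').

Lemma measurable_coordY (i : 'I_p) :
  measurable_fun setT (fun y : Y => set_val y ord0 i).
Proof.
apply: (measurability _ (RGenOpens.measurableE R)).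
move=> _ [_ [a [b ->] <-]]; rewrite setTI; apply: sub_sigma_algebra.
exists ((fun x : 'rV[R]_p => x ord0 i) @^-1` `]a, b[%classic) => //.
apply: open_comp; last exact: interval_open.
by move=> x _; exact: coord_continuous.
Qed.

Lemma measurable_distY d (T : measurableType d) (f g : T -> Y) :
  measurable_fun setT f -> measurable_fun setT g ->
  measurable_fun setT (fun t => distY (f t) (g t)).
Proof.
move=> mf mg.
apply: (@measurableT_comp _ _ _ _ _ _ (@Num.sqrt R)).
  by apply: continuous_measurable_fun; exact: sqrt_continuous.
apply: measurable_sum => i.
apply: measurable_funX; apply: measurable_funB.
  exact: (measurableT_comp (measurable_coordY i) mf).
exact: (measurableT_comp (measurable_coordY i) mg).
Qed.

(** Assigning a point to the first ball of the net that contains it turns overlapping balls into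
    disjoint measurable cells. *)
Lemma measurable_find d (T : measurableType d) (C : Type) (q : C -> T -> bool)
    (s : seq C) (k : nat) : (forall c, measurable [set y | q c y]) ->
  measurable [set y | find (q ^~ y) s = k].
Proof.
move=> mq; elim: s k => [|c s IH] k /=.
  by case: k => [|k]; [rewrite (_ : mkset _ = setT)|rewrite (_ : mkset _ = set0)];
    rewrite //; apply/seteqP; split.
case: k => [|k].
  rewrite (_ : mkset _ = [set y | q c y])//.
  by apply/seteqP; split => y /=; case: (q c y).
rewrite (_ : mkset _ = ~` [set y | q c y] `&` [set y | find (q ^~ y) s = k]).
  by apply: measurableI => //; exact: measurableC.
apply/seteqP; split => y /=; case: (q c y) => //.
- by move=> [<-].
- by move=> [].
- by move=> [_ ->].
Qed.

Hypothesis cptY : compact Yset.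

Lemma finite_net (e : R) : 0 < e ->
  exists (N : nat) (c : 'I_N.+1 -> Y) (idx : Y -> 'I_N.+1),
    (forall i, measurable (idx @^-1` [set i])) /\
    forall y, distY y (c (idx y)) <= e.
Proof.
move=> e0; move: (cptY); rewrite compact_cover.
move=> /(_ (set_type Yset) setT (fun c => [set x | eucl_dist x (set_val c) < e])).
move=> [c _| x Yx|D _ YD].
- rewrite (_ : mkset _ =
      (fun x => eucl_dist x (set_val c)) @^-1` `]-oo, e[%classic).
    apply: open_comp; last exact: interval_open.
    by move=> x _; exact: eucl_dist_continuous.
  by apply/seteqP; split => x /=; rewrite in_itv.
- by exists (exist _ x (mem_set Yx)) => //=; rewrite eucl_distxx.
(* Putting [y0] in front makes the list of centres nonempty, so that its indices form a type
   ['I_N.+1]. *)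
pose s : seq Y := (y0 : Y) :: finmap.enum_fset D.
pose q (c y : Y) := distY y c < e.
have has_s y : has (q ^~ y) s.
  have [c cD cy] := YD (set_val y) (set_valP y).
  by apply/hasP; exists c => //; rewrite inE; apply/orP; right.
have find_lt y : (find (q ^~ y) s < size s)%N by rewrite -has_find.
exists (size (finmap.enum_fset D)), (fun i => nth (y0 : Y) s i),
  (fun y => Ordinal (find_lt y)); split => [i|y].
  rewrite (_ : _ @^-1` _ = [set y | find (q ^~ y) s = i]).
    apply: measurable_find => c; rewrite -[X in measurable X]setTI.
    apply: measurable_fun_ltr => //.
    exact: (@measurable_distY _ Y id (cst c)).
  by apply/seteqP; split => y /=; [move=> <-|move=> H; exact: val_inj].
by apply/ltW; exact: (@nth_find _ (y0 : Y) (q ^~ y) s (has_s y)).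
Qed.

Lemma distY_bounded : exists2 D : R, 0 < D & forall y y', distY y y' <= D.
Proof.
have [N [c [idx [_ idxP]]]] := finite_net ltr01.
pose B := \sum_i distY (y0 : Y) (c i).
have B0 : 0 <= B by apply: sumr_ge0 => i _; exact: eucl_dist_ge0.
have yB y : distY y y0 <= 1 + B.
  rewrite (le_trans (eucl_dist_triangle _ (set_val (c (idx y))) _))//.
  apply: lerD; first exact: idxP.
  rewrite eucl_distC /B (bigD1 (idx y))//= lerDl.
  by apply: sumr_ge0 => i _; exact: eucl_dist_ge0.
exists (2 * (1 + B)) => [|y y']; first by rewrite mulr_gt0// ltr_pwDl.
rewrite (le_trans (eucl_dist_triangle _ (set_val (y0 : Y)) _))//.
rewrite mulr_natl mulr2n; apply: lerD; first exact: yB.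
by rewrite eucl_distC; exact: yB.
Qed.

End outcome_space.

(** * From finite plans to couplings *)

Section completion.
Context (R : realType) (N : nat).
Notation I := 'I_N.+1.
Implicit Types (m n : I -> R) (q : I -> I -> R).

Lemma mass_col q : mass q = \sum_j colsum q j.
Proof. exact: exchange_big. Qed.

(* The density, with respect to the product of [m] and [n], of the partial plan
   [q] completed by the normalised product of its marginal defects. On a null
   cell [x / 0 = 0], so the first ratio vanishes, the second factor is [1], and
   the density still integrates to one there; this needs [mass q < 1]. *)
Definition completion m n q i j : R :=
  q i j / (m i * n j) +
  (1 - rowsum q i / m i) * (1 - colsum q j / n j) / (1 - mass q).

Variables (m n : I -> R) (q : I -> I -> R).
Hypotheses (m0 : forall i, 0 <= m i) (n0 : forall j, 0 <= n j).
Hypotheses (m1 : \sum_i m i = 1) (n1 : \sum_j n j = 1).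
Hypotheses (q0 : forall i j, 0 <= q i j) (mass1 : mass q < 1).
Hypotheses (rowm : forall i, rowsum q i <= m i).
Hypotheses (coln : forall j, colsum q j <= n j).

Let row0 i : 0 <= rowsum q i. Proof. exact: sumr_ge0. Qed.
Let col0 j : 0 <= colsum q j. Proof. exact: sumr_ge0. Qed.

Let q_row i j : m i = 0 -> q i j = 0.
Proof.
move=> mi; apply/eqP; rewrite eq_le q0 andbT -mi (le_trans _ (rowm i))//.
by rewrite /rowsum (bigD1 j)//= lerDl sumr_ge0.
Qed.

Let q_col i j : n j = 0 -> q i j = 0.
Proof.
move=> nj; apply/eqP; rewrite eq_le q0 andbT -nj (le_trans _ (coln j))//.
by rewrite /colsum (bigD1 i)//= lerDl sumr_ge0.
Qed.

Let row_m i : rowsum q i / m i * m i = rowsum q i.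
Proof.
have [mi|mi] := eqVneq (m i) 0; last by rewrite divfK.
by rewrite mi mulr0 /rowsum big1// => j _; exact: q_row.
Qed.

Let col_n j : colsum q j / n j * n j = colsum q j.
Proof.
have [nj|nj] := eqVneq (n j) 0; last by rewrite divfK.
by rewrite nj mulr0 /colsum big1// => i _; exact: q_col.
Qed.

Let ratio (x y : R) : 0 <= x <= y -> 0 <= 1 - x / y.
Proof.
move=> /andP[x0 xy]; rewrite subr_ge0.
have [->|y_neq0] := eqVneq y 0; first by rewrite invr0 mulr0 ler01.
have y0 : 0 < y by rewrite lt_neqAle eq_sym y_neq0 (le_trans x0).
by rewrite ler_pdivrMr// mul1r.
Qed.

Lemma completion_ge0 i j : 0 <= completion m n q i j.
Proof.
rewrite addr_ge0 ?divr_ge0 ?mulr_ge0//; last by rewrite subr_ge0 ltW.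
- by rewrite ratio// row0 rowm.
- by rewrite ratio// col0 coln.
Qed.

Let mass_neq0 : 1 - mass q != 0.
Proof. by rewrite gt_eqF// subr_gt0. Qed.

Lemma completion_row i : \sum_j completion m n q i j * n j = 1.
Proof.
under eq_bigr => j _.
  have -> : completion m n q i j * n j = q i j / m i +
      (1 - rowsum q i / m i) / (1 - mass q) * (n j - colsum q j).
    rewrite mulrDl; congr (_ + _).
      rewrite invfM mulrA.
      have [nj|nj] := eqVneq (n j) 0; last by rewrite -mulrA mulVf// mulr1.
      by rewrite q_col// !mul0r.
    rewrite -[in RHS](col_n j); ring.
  over.
rewrite big_split/= -mulr_suml -mulr_sumr sumrB n1 -mass_col.
by rewrite divfK// -/(rowsum q i) subrKC.
Qed.

Lemma completion_col j : \sum_i completion m n q i j * m i = 1.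
Proof.
under eq_bigr => i _.
  have -> : completion m n q i j * m i = q i j / n j +
      (1 - colsum q j / n j) / (1 - mass q) * (m i - rowsum q i).
    rewrite mulrDl; congr (_ + _).
      rewrite invfM [_^-1 * _^-1]mulrC mulrA.
      have [mi|mi] := eqVneq (m i) 0; last by rewrite -mulrA mulVf// mulr1.
      by rewrite q_row// !mul0r.
    rewrite -[in RHS](row_m i); ring.
  over.
rewrite big_split/= -mulr_suml -mulr_sumr sumrB m1.
by rewrite divfK// -/(colsum q j) subrKC.
Qed.

Lemma completionE i j : completion m n q i j * (m i * n j) =
  q i j + (m i - rowsum q i) * (n j - colsum q j) / (1 - mass q).
Proof.
rewrite mulrDl; congr (_ + _).
  have [mi|mi] := eqVneq (m i) 0; first by rewrite q_row// !mul0r.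
  have [nj|nj] := eqVneq (n j) 0; first by rewrite q_col// !mul0r.
  by rewrite divfK// mulf_neq0.
rewrite -[in RHS](col_n j) -[in RHS](row_m i); ring.
Qed.

Variables (d : I -> I -> R) (v : I -> R) (D delta e : R).
Hypothesis d_ge0 : forall i j, 0 <= d i j.
Hypothesis d_le : forall i j, d i j <= D.
Hypothesis d_triangle : forall i j k, d i k <= d i j + d j k.
Hypothesis e0 : 0 <= e.
Hypothesis mass_delta : 1 - delta <= mass q.
Hypothesis costq :
  plan_cost d q <= \sum_i minext v (d i) * (m i - n i) + delta.

Local Notation F i := (minext v (d i)).

Lemma minext_lip i j : F i <= F j + d i j.
Proof.
by apply: minext_shift => k; rewrite -addrA lerD2l addrC d_triangle.
Qed.

(** On the part [q] the hypothesis [costq] cancels the potential terms up to [delta], once [m] and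
    [n] replace the marginals of [q]. Both defects have the same mass [1 - mass q], so only the
    oscillation of [minext], at most [D] around its value at [ord0], enters, for a total of [2 * D]
    times that mass. The added product part has the same mass and an integrand at most
    [2 * D + e]. *)
Lemma completion_gap : \sum_i \sum_j
    (d i j - F i + F j + e) * (completion m n q i j * (m i * n j)) <=
  e + delta * (1 + 4 * D + e).
Proof.
pose M := 1 - mass q.
have M0 : 0 < M by rewrite subr_gt0.
have Mdelta : M <= delta by rewrite /M; have := mass_delta; lra.
have D0 : 0 <= D by exact: le_trans (d_ge0 ord0 ord0) _.
have sumr : \sum_i (m i - rowsum q i) = M by rewrite sumrB m1.
have sumc : \sum_j (n j - colsum q j) = M by rewrite sumrB n1 -mass_col.
have FD i : `|F i - F ord0| <= D.
  rewrite ler_norml; have := minext_lip i ord0; have := minext_lip ord0 i.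
  by have := d_le i ord0; have := d_le ord0 i; lra.
have costE : \sum_i \sum_j (d i j - F i + F j + e) * q i j =
    plan_cost d q - \sum_i F i * rowsum q i + \sum_j F j * colsum q j +
    e * mass q.
  have -> : \sum_j F j * colsum q j = \sum_i \sum_j F j * q i j.
    by rewrite exchange_big; apply: eq_bigr => j _; rewrite mulr_sumr.
  rewrite mulr_sumr -sumrB -!big_split/=; apply: eq_bigr => i _.
  rewrite !mulr_sumr -sumrB -!big_split/=; apply: eq_bigr => j _; ring.
have restE : \sum_i \sum_j
    ((m i - rowsum q i) * (n j - colsum q j) / M) = M.
  under eq_bigr do rewrite -mulr_suml -mulr_sumr sumc.
  by rewrite -2!mulr_suml sumr mulfK// gt_eqF.
have rest_le : \sum_i \sum_j (d i j - F i + F j + e) *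
    ((m i - rowsum q i) * (n j - colsum q j) / M) <= (2 * D + e) * M.
  rewrite -[in leRHS]restE mulr_sumr; apply: ler_sum => i _.
  rewrite mulr_sumr; apply: ler_sum => j _; apply: ler_wpM2r.
    by rewrite divr_ge0 ?mulr_ge0 ?subr_ge0// ltW// subr_gt0.
  by have := minext_lip j i; have := d_le j i; have := d_le i j; lra.
have Frow : \sum_i F i * (m i - rowsum q i) <= (F ord0 + D) * M.
  rewrite -sumr mulr_sumr; apply: ler_sum => i _; apply: ler_wpM2r.
    by rewrite subr_ge0.
  by have := FD i; rewrite ler_norml; lra.
have Fcol : (F ord0 - D) * M <= \sum_j F j * (n j - colsum q j).
  rewrite -sumc mulr_sumr; apply: ler_sum => j _; apply: ler_wpM2r.
    by rewrite subr_ge0.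
  by have := FD j; rewrite ler_norml; lra.
under eq_bigr do under eq_bigr do rewrite completionE -/M mulrDr.
under eq_bigr do rewrite big_split/=.
rewrite big_split/= costE.
have costq' : plan_cost d q <= \sum_i F i * m i - \sum_i F i * n i + delta.
  by rewrite -sumrB; under [in leRHS]eq_bigr do rewrite -mulrBr.
have FrowE : \sum_i F i * (m i - rowsum q i) =
    \sum_i F i * m i - \sum_i F i * rowsum q i.
  by rewrite -sumrB; apply: eq_bigr => i _; rewrite mulrBr.
have FcolE : \sum_i F i * (n i - colsum q i) =
    \sum_i F i * n i - \sum_i F i * colsum q i.
  by rewrite -sumrB; apply: eq_bigr => i _; rewrite mulrBr.
have eM : e * mass q <= e by rewrite ler_piMr// ltW.
have DM : (4 * D + e) * M <= (4 * D + e) * delta.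
  by rewrite ler_wpM2l// addr_ge0// mulr_ge0.
lra.
Qed.

End completion.

Section pack_measure.
Context d (T : measurableType d) (R : realType) (m : {measure set T -> \bar R}).
Let F : set T -> \bar R := m.
Let F_isMeasure := isMeasure.Build _ _ _ F (measure0 m) (measure_ge0 m)
  (@measure_semi_sigma_additive _ _ _ m).
Let mF : {measure set T -> \bar R} := HB.pack F F_isMeasure.

Lemma pack_finite_measure : fin_num_fun m ->
  exists n : {finite_measure set T -> \bar R}, forall A, n A = m A.
Proof.
move=> mfin; pose n : {finite_measure set T -> \bar R} :=
  HB.pack F F_isMeasure (Measure_isFinite.Build _ _ _ mF mfin).
by exists n.
Qed.

Lemma pack_probability : m setT = 1%E ->
  exists n : probability T R, forall A, n A = m A.
Proof.
move=> m1; pose n : probability T R :=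
  HB.pack F F_isMeasure (Measure_isProbability.Build _ _ _ mF m1).
by exists n.
Qed.

End pack_measure.

Lemma density_measure d (T : measurableType d) (R : realType)
    (m : {measure set T -> \bar R}) (s : T -> R) :
  measurable_fun setT s -> (forall x, 0 <= s x) ->
  exists n : {measure set T -> \bar R},
    forall A, n A = (\int[m]_(x in A) (s x)%:E)%E.
Proof.
move=> ms s0; pose F (A : set T) := (\int[m]_(x in A) (s x)%:E)%E.
have F0 : F set0 = 0%E by rewrite /F integral_set0.
have Fge0 A : (0 <= F A)%E by apply: integral_ge0 => x _; rewrite lee_fin.
have Fsigma : semi_sigma_additive F.
  move=> E mE tE mUE; rewrite [X in _ --> X](_ : _ =
      (\sum_(0 <= n <oo) F (E n))%E); first exact: is_cvg_nneseries.
  apply: ge0_integral_bigcup => //.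
    by apply: measurable_funTS; exact/measurable_EFinP.
  by move=> x _; rewrite lee_fin.
pose n : {measure set T -> \bar R} :=
  HB.pack F (isMeasure.Build _ _ _ F F0 Fge0 Fsigma).
by exists n.
Qed.

Section cells.
Context d (Y : measurableType d) (R : realType) (N : nat).
Notation I := 'I_N.+1.
Variable idx : Y -> I.
Hypothesis midx : forall i, measurable (idx @^-1` [set i]).

Definition cell i := idx @^-1` [set i].

Let mcell i : measurable (cell i). Proof. exact: midx. Qed.

Lemma step_fun_sum (r : I -> R) y :
  r (idx y) = \sum_i r i * \1_(cell i) y.
Proof.
rewrite (bigD1 (idx y))//= big1 => [|i /eqP iy]; rewrite indicE.
  by rewrite mem_set// mulr1 addr0.
by rewrite memNset ?mulr0// => iy'; apply: iy; rewrite /cell/= in iy'.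
Qed.

Lemma measurable_step_fun dT (T : measurableType dT) (f : T -> Y)
    (g : T -> I -> R) : measurable_fun setT f ->
  (forall i, measurable_fun setT (g ^~ i)) ->
  measurable_fun setT (fun t => g t (idx (f t))).
Proof.
move=> mf mg.
have -> : (fun t => g t (idx (f t))) =
    (fun t => \sum_i g t i * \1_(cell i) (f t)).
  by apply/funext => t; exact: step_fun_sum.
apply: measurable_sum => i; apply: measurable_funM => //.
apply: (measurableT_comp _ mf); apply: measurable_indic; exact: mcell.
Qed.

Variable k : {measure set Y -> \bar R}.
Hypothesis kfin : fin_num_fun k.

Lemma integral_step_fun (r : I -> R) A : (forall i, 0 <= r i) ->
  measurable A -> (\int[k]_(y in A) (r (idx y))%:E =
    (\sum_i r i * fine (k (A `&` cell i)))%:E)%E.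
Proof.
move=> r0 mA.
under eq_integral do rewrite step_fun_sum -sumEFin.
rewrite ge0_integral_sum//.
- rewrite -sumEFin; apply: eq_bigr => i _.
  rewrite EFinM fineK ?kfin//; last exact: measurableI.
  under eq_integral do rewrite EFinM.
  rewrite ge0_integralZl_EFin//; first by rewrite integral_indic// setIC.
  by apply/measurable_EFinP; apply: measurable_indic; exact: mcell.
- by move=> i; apply/measurable_EFinP; apply: measurable_funM.
- by move=> i y _; rewrite lee_fin mulr_ge0.
Qed.

Lemma cells_sum A : measurable A ->
  fine (k A) = \sum_i fine (k (A `&` cell i)).
Proof.
move=> mA; have := @integral_step_fun (fun=> 1) A (fun=> ler01) mA.
rewrite integral_cst// mul1e => ->.
by apply: eq_bigr => i _; rewrite mul1r.
Qed.

End cells.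

Section kernel_fst.
Context d d' (W : measurableType d) (Y : measurableType d') (R : realType).
Variable k : R.-pker W ~> Y.

(** Extending [semidirect Q mu] by [kernel_fst nu] gives [Q(dw) mu_w(dy) nu_w(dy')], the coupling
    with independent outcomes given [w]. *)
Definition kernel_fst (z : W * Y) : {measure set Y -> \bar R} := k z.1.

Let measurable_kernel_fst B : measurable B ->
  measurable_fun setT (kernel_fst ^~ B).
Proof.
by move=> mB; apply: (measurableT_comp (measurable_kernel k B mB)).
Qed.

HB.instance Definition _ := isKernel.Build _ _ _ _ _ kernel_fst
  measurable_kernel_fst.

Let kernel_fst_prob z : kernel_fst z setT = 1%E.
Proof. exact: prob_kernel. Qed.

HB.instance Definition _ := Kernel_isProbability.Build _ _ _ _ _
  kernel_fst kernel_fst_prob.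

End kernel_fst.

Section cell_coupling.
Context d d' (W : measurableType d) (Y : measurableType d') (R : realType).
Variables (Q : probability W R) (mu nu : R.-pker W ~> Y).
Variables (N : nat).
Notation I := 'I_N.+1.
Variable idx : Y -> I.
Hypothesis midx : forall i, measurable (idx @^-1` [set i]).
Variable sigma : W -> I -> I -> R.
Hypothesis msigma : forall i j, measurable_fun setT (fun w => sigma w i j).
Hypothesis sigma0 : forall w i j, 0 <= sigma w i j.
Hypothesis sigma_nu : forall w i,
  \sum_j sigma w i j * fine (nu w (cell idx j)) = 1.
Hypothesis sigma_mu : forall w j,
  \sum_i sigma w i j * fine (mu w (cell idx i)) = 1.
Local Open Scope ereal_scope.

Let mufin w : fin_num_fun (mu w). Proof. exact: kernel_finite_transition. Qed.
Let nufin w : fin_num_fun (nu w). Proof. exact: kernel_finite_transition. Qed.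

Let S w y y' := sigma w (idx y) (idx y').

Let mS : measurable_fun setT (fun z : (W * Y) * Y => S z.1.1 z.1.2 z.2).
Proof.
have m11 : measurable_fun setT (fun z : (W * Y) * Y => z.1.1).
  exact: measurableT_comp.
have m12 : measurable_fun setT (fun z : (W * Y) * Y => z.1.2).
  exact: measurableT_comp.
apply: (measurable_step_fun midx
  (g := fun z j => sigma z.1.1 (idx z.1.2) j)) => // j.
apply: (measurable_step_fun midx (g := fun z i => sigma z.1.1 i j)) => //.
by move=> i; exact: measurableT_comp (msigma i j) m11.
Qed.

Let base := semidirect (semidirect Q mu) (kernel_fst nu).

Let integral_base (f : (W * Y) * Y -> \bar R) :
  measurable_fun setT f -> (forall z, 0 <= f z) ->
  \int[base]_z f z = \int[Q]_w \int[mu w]_y \int[nu w]_y' f ((w, y), y').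
Proof.
move=> mf f0; rewrite integral_semidirect// integral_semidirect//.
- exact: measurable_fun_kernel_integral.
- by move=> z; exact: integral_ge0.
Qed.

Let integral_S_nu w i A : measurable A ->
  \int[nu w]_(y' in A) (sigma w i (idx y'))%:E =
  (\sum_j sigma w i j * fine (nu w (A `&` cell idx j)))%:E.
Proof. by move=> mA; exact: (integral_step_fun midx (@nufin w) (sigma0 w i)). Qed.

(** The conditionally independent coupling is reweighted by [sigma]. The integral formula determines
    it, and the later lemmas use nothing else. *)
Lemma cell_coupling : exists a : probability ((W * Y) * (W * Y))%type R,
  forall f : (W * Y) * (W * Y) -> \bar R,
    measurable_fun setT f -> (forall z, 0 <= f z) ->
    \int[a]_z f z = \int[Q]_w \int[mu w]_y \int[nu w]_y'
      (f ((w, y), (w, y')) * (sigma w (idx y) (idx y'))%:E).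
Proof.
have S0 (z : (W * Y) * Y) : (0 <= S z.1.1 z.1.2 z.2)%R by exact: sigma0.
have mS' : measurable_fun setT
    (fun z : (W * Y) * Y => (S z.1.1 z.1.2 z.2)%:E) by exact/measurable_EFinP.
have S1 : \int[base]_z (S z.1.1 z.1.2 z.2)%:E = 1.
  rewrite integral_base//.
  rewrite /S/= (eq_integral (cst 1)) => [|w _]; last first.
    rewrite (eq_integral (cst 1)) => [|y _]; last first.
      rewrite integral_S_nu//; congr (_ %:E); rewrite -[RHS](sigma_nu w (idx y)).
      by apply: eq_bigr => j _; rewrite setTI.
    by rewrite integral_cst// mul1e prob_kernel.
  by rewrite integral_cst// mul1e; exact: probability_setT.
have [b0 b0E] := density_measure base mS S0.
have [b bE'] : exists b : probability _ R, forall A, b A = b0 A.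
  by apply: pack_probability; rewrite b0E.
have bE A : measurable A -> b A = \int[base]_(z in A) (S z.1.1 z.1.2 z.2)%:E.
  by rewrite bE' b0E.
(* Copying [w] into both pairs puts the [(w, w')]-marginal on the diagonal. *)
pose phi (z : (W * Y) * Y) : (W * Y) * (W * Y) := (z.1, (z.1.1, z.2)).
have mphi : measurable_fun setT phi.
  apply: measurable_fun_pair => //; apply: measurable_fun_pair => //.
  exact: measurableT_comp.
pose phi' : {mfun ((W * Y) * Y)%type >-> ((W * Y) * (W * Y))%type} :=
  HB.pack phi (isMeasurableFun.Build _ _ _ _ phi mphi).
exists (distribution b phi') => f mf f0.
rewrite ge0_integral_pushforward//.
have mfphi : measurable_fun setT (f \o phi) by exact: measurableT_comp.
have fphi0 z : 0 <= (f \o phi) z by exact: f0.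
rewrite preimage_setT (integral_density mS S0 bE mfphi fphi0).
rewrite integral_base//; first exact: emeasurable_funM.
by move=> z; rewrite mule_ge0// lee_fin.
Qed.

Variable a : probability ((W * Y) * (W * Y))%type R.
Hypothesis aE : forall f : (W * Y) * (W * Y) -> \bar R,
    measurable_fun setT f -> (forall z, 0 <= f z) ->
    \int[a]_z f z = \int[Q]_w \int[mu w]_y \int[nu w]_y'
      (f ((w, y), (w, y')) * (sigma w (idx y) (idx y'))%:E).

Let aindicE A : measurable A ->
  a A = \int[Q]_w \int[mu w]_y \int[nu w]_y'
      ((\1_A ((w, y), (w, y')))%:E * (sigma w (idx y) (idx y'))%:E).
Proof.
move=> mA; rewrite -[X in a X](setIT A) -integral_indic// aE//.
by apply/measurable_EFinP; exact: measurable_indic.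
Qed.

(** The event [A] is compared with [E] only where both copies of [w] agree, so one statement covers
    the first marginal and the diagonal condition. The inner integral of the density is one by
    [sigma_nu]. *)
Lemma cell_coupling_fst A (E : set (W * Y)) : measurable A -> measurable E ->
  (forall w y y', A ((w, y), (w, y')) <-> E (w, y)) -> a A = semidirect Q mu E.
Proof.
move=> mA mE AE; rewrite aindicE// -[in RHS](setIT E) -integral_indic//.
have mE' : measurable_fun setT (fun z => (\1_E z)%:E : \bar R).
  by apply/measurable_EFinP; exact: measurable_indic.
rewrite integral_semidirect//; apply: eq_integral => w _.
apply: eq_integral => y _.
under eq_integral => y' _.
  have -> : \1_A ((w, y), (w, y')) = \1_E (w, y) :> R.
    rewrite !indicE; congr ((nat_of_bool _)%:R); apply/idP/idP; rewrite !inE.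
      by move/AE.
    by move=> Ewy; apply/AE.
  over.
rewrite ge0_integralZl_EFin//.
- rewrite integral_S_nu// (_ : (\sum_j _)%R = 1%R) ?mule1//.
  by rewrite -[RHS](sigma_nu w (idx y)); apply: eq_bigr => j _; rewrite setTI.
- by move=> y' _; rewrite lee_fin.
- apply/measurable_EFinP.
  exact: (measurable_step_fun midx (g := fun=> sigma w (idx y))).
Qed.

(** Besides the second marginal this gives the law of the mixed pair [(w, y')]. The density is
    summed over the first outcome by [sigma_mu], after cutting the section of [E] into cells. *)
Lemma cell_coupling_snd A (E : set (W * Y)) : measurable A -> measurable E ->
  (forall w y y', A ((w, y), (w, y')) <-> E (w, y')) -> a A = semidirect Q nu E.
Proof.
move=> mA mE AE; rewrite aindicE//; apply: eq_integral => w _.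
have mEw : measurable (xsection E w) by exact: measurable_xsection.
pose r i := (\sum_j sigma w i j * fine (nu w (xsection E w `&` cell idx j)))%R.
transitivity (\int[mu w]_y (r (idx y))%:E).
  apply: eq_integral => y _; rewrite -integral_S_nu// [RHS]integral_mkcond.
  apply: eq_integral => y' _; rewrite /patch indicE.
  have -> : (((w, y), (w, y')) \in A) = (y' \in xsection E w).
    by rewrite mem_xsection; apply/idP/idP; rewrite !inE => /AE.
  by case: ifPn; rewrite ?mul1e ?mul0e.
have r0 i : (0 <= r i)%R.
  by apply: sumr_ge0 => j _; rewrite mulr_ge0// fine_ge0.
rewrite (integral_step_fun midx (@mufin w) r0)//.
rewrite -[RHS]fineK ?nufin//; congr (_ %:E).
rewrite (cells_sum midx (@nufin w) mEw).
under eq_bigr do rewrite mulr_suml.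
rewrite exchange_big/=; apply: eq_bigr => j _.
rewrite -[RHS]mul1r -[in RHS](sigma_mu w j) mulr_suml.
by apply: eq_bigr => i _; rewrite setTI mulrAC.
Qed.

(** A bound that is constant on products of cells turns the integral, for each [w], into the finite
    sum that [completion_gap] controls. *)
Lemma cell_coupling_le (f : (W * Y) * (W * Y) -> \bar R)
    (g : W -> I -> I -> R) (c : R) :
  measurable_fun setT f -> (forall z, 0 <= f z) ->
  (forall w i j, 0 <= g w i j)%R ->
  (forall w y y', f ((w, y), (w, y')) <= (g w (idx y) (idx y'))%:E) ->
  (forall w, \sum_i \sum_j g w i j * (sigma w i j *
     (fine (mu w (cell idx i)) * fine (nu w (cell idx j)))) <= c)%R ->
  \int[a]_z f z <= c%:E.
Proof.
move=> mf f0 g0 fg gc; rewrite aE//.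
have c_int : c%:E = \int[Q]_w c%:E.
  by rewrite integral_cst// [X in _ * X]probability_setT mule1.
pose h (z : (W * Y) * Y) := f (z.1, (z.1.1, z.2)) * (S z.1.1 z.1.2 z.2)%:E.
have h0 z : 0 <= h z by rewrite mule_ge0// lee_fin sigma0.
have mh : measurable_fun setT h.
  apply: emeasurable_funM; last exact/measurable_EFinP.
  apply: (measurableT_comp mf); apply: measurable_fun_pair => //.
  by apply: measurable_fun_pair => //; exact: measurableT_comp.
have mh1 : measurable_fun setT (fun z => \int[nu z.1]_y' h (z, y')).
  exact: (measurable_fun_kernel_integral (kernel_fst nu) mh).
have h10 z : 0 <= \int[nu z.1]_y' h (z, y') by exact: integral_ge0.
rewrite c_int; apply: ge0_le_integral => //.
- by move=> w _; apply: integral_ge0 => y _; exact: (h10 (w, y)).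
- exact: (measurable_fun_kernel_integral mu mh1).
move=> w _; pose gs i j := (g w i j * sigma w i j)%R.
have gs0 i j : (0 <= gs i j)%R by rewrite mulr_ge0.
pose r i := (\sum_j gs i j * fine (nu w (cell idx j)))%R.
have r0 i : (0 <= r i)%R by apply: sumr_ge0 => j _; rewrite mulr_ge0// fine_ge0.
apply: (@le_trans _ _ (\int[mu w]_y (r (idx y))%:E)).
  apply: ge0_le_integral => //.
  - by move=> y _; exact: (h10 (w, y)).
  - by apply: (measurableT_comp mh1); exact: measurable_pair1.
  - by apply/measurable_EFinP; exact: (measurable_step_fun midx (g := fun=> r)).
  move=> y _.
  have -> : (r (idx y))%:E = \int[nu w]_y' (gs (idx y) (idx y'))%:E.
    rewrite (integral_step_fun midx (@nufin w) (gs0 (idx y)))//.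
    by congr (_ %:E); apply: eq_bigr => j _; rewrite setTI.
  apply: ge0_le_integral => //.
  - by move=> y' _; exact: (h0 ((w, y), y')).
  - exact: (measurableT_comp mh (measurable_pair1 (w, y))).
  - apply/measurable_EFinP.
    exact: (measurable_step_fun midx (g := fun=> gs (idx y))).
  move=> y' _; rewrite /h /gs EFinM; apply: lee_wpmul2r => //.
  by rewrite lee_fin sigma0.
rewrite (integral_step_fun midx (@mufin w) r0)// lee_fin.
apply: le_trans (gc w); rewrite le_eqVlt; apply/orP; left; apply/eqP.
apply: eq_bigr => i _; rewrite setTI mulr_suml; apply: eq_bigr => j _.
by rewrite /gs; ring.
Qed.

End cell_coupling.

(** * Kantorovich duality for the extended Wasserstein distance *)

Section bounded_integrals.
Context d (T : measurableType d) (R : realType).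

Lemma bounded_integrable (a : probability T R) (f : T -> R) (D : R) :
  measurable_fun setT f -> (forall x, `|f x| <= D) ->
  a.-integrable setT (EFin \o f).
Proof.
move=> mf fD; apply: measurable_bounded_integrable => //.
  by rewrite -ge0_fin_numE// fin_num_measure.
exists D; split; first exact: num_real.
by move=> M DM x _; exact: le_trans (fD x) (ltW DM).
Qed.

End bounded_integrals.

Section integral_law.
Context d d' (T : measurableType d) (S : measurableType d') (R : realType).
Variables (a : {measure set T -> \bar R}) (P : {measure set S -> \bar R}).
Variable phi : T -> S.
Hypothesis mphi : measurable_fun setT phi.
Hypothesis aP : forall A, measurable A -> a (phi @^-1` A) = P A.

Lemma ge0_integral_law (f : S -> \bar R) : measurable_fun setT f ->
  (forall x, 0 <= f x)%E -> (\int[a]_x f (phi x) = \int[P]_x f x)%E.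
Proof.
move=> mf f0.
pose phi' : {mfun T >-> S} :=
  HB.pack phi (isMeasurableFun.Build _ _ _ _ phi mphi).
have <- : (\int[pushforward a phi']_x f x = \int[P]_x f x)%E.
  by apply: eq_measure_integral => A mA _; exact: aP.
by rewrite ge0_integral_pushforward.
Qed.

Lemma integral_law (f : S -> R) : measurable_fun setT f ->
  (\int[a]_x (f (phi x))%:E = \int[P]_x (f x)%:E)%E.
Proof.
move=> mf; have mf' : measurable_fun setT (EFin \o f) by exact/measurable_EFinP.
rewrite [LHS]integralE [RHS]integralE; congr (_ - _)%E.
  rewrite -(ge0_integral_law (measurable_funepos mf') (funepos_ge0 _)).
  by apply: eq_integral => x _; rewrite !funeposE.
rewrite -(ge0_integral_law (measurable_funeneg mf') (funeneg_ge0 _)).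
by apply: eq_integral => x _; rewrite !funenegE.
Qed.

End integral_law.

(** * Measurable choice among countably many candidates *)

Section measurable_selection.
Context d (T : measurableType d).

Lemma measurable_forall_fin (I : finType) (A : I -> set T) :
  (forall i, measurable (A i)) -> measurable [set t | forall i, A i t].
Proof.
move=> mA; rewrite (_ : mkset _ = \bigcap_(i in setT) A i).
  by apply: fin_bigcap_measurable.
by apply/seteqP; split => t /= At i; [move=> _|]; exact: At.
Qed.

Lemma measurable_first_index (C : nat -> set T) :
  (forall n, measurable (C n)) -> (forall t, exists n, C n t) ->
  exists k : T -> nat, (forall t, C (k t) t) /\
    forall n, measurable (k @^-1` [set n]).
Proof.
move=> mC exC.
have exC' t : exists n, `[< C n t >].
  by have [n Cn] := exC t; exists n; exact/asboolP.
exists (fun t => ex_minn (exC' t)); split => [t|n].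
  by case: ex_minnP => n /asboolP.
rewrite (_ : _ @^-1` _ = C n `&` [set t | forall i : 'I_n, (~` C i) t]).
  apply: measurableI => //.
  by apply: measurable_forall_fin => i; exact: measurableC.
apply/seteqP; split => t /=.
  case: ex_minnP => k /asboolP Ck kmin <-; split => // i Ci.
  by have := kmin i (introT (asboolP _) Ci); rewrite leqNgt ltn_ord.
move=> [Cn nC]; case: ex_minnP => k /asboolP Ck kmin.
apply/eqP; rewrite eqn_leq kmin ?andTb; last exact/asboolP.
rewrite leqNgt; apply/negP => kn; exact: (nC (Ordinal kn)).
Qed.

Lemma measurable_select d' (U : measurableType d') (k : T -> nat)
    (G : nat -> T -> U) : (forall n, measurable (k @^-1` [set n])) ->
  (forall n, measurable_fun setT (G n)) ->
  measurable_fun setT (fun t => G (k t) t).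
Proof.
move=> mk mG _ B mB; rewrite setTI.
rewrite (_ : _ @^-1` B = \bigcup_n (k @^-1` [set n] `&` G n @^-1` B)).
  apply: bigcup_measurable => n _; apply: measurableI => //.
  by rewrite -[X in measurable X]setTI; exact: mG.
apply/seteqP; split => t /= => [GB|[n _ [<-]]//].
by exists (k t).
Qed.

End measurable_selection.

Section weak_duality.
Context (R : realType) (p : nat) (Yset : set 'rV[R]_p) (y0 : set_type Yset).
Hypothesis cptY : compact Yset.
Context dW (W : measurableType dW).
Notation Y := (borel_sub y0).
Hypothesis mdiag : measurable [set w : W * W | w.1 = w.2].
Variables (Q : probability W R) (mu nu : R.-pker W ~> Y).

(** A critic is constrained only for almost every [w]. Setting it to zero over the exceptional null
    set makes the Lipschitz bound hold everywhere, and with the value 0 at [y0] this bounds it by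
    [D]. Its integrals do not change, as every [semidirect Q k] has the same first marginal. *)
Lemma critic_version (D : R) (h : W * Y -> R) :
  (forall y y' : Y, distY y y' <= D) -> critics Q h ->
  exists h' : W * Y -> R, [/\ measurable_fun setT h',
    (forall z, `|h' z| <= D),
    (forall w y y', h' (w, y) - h' (w, y') <= distY y y') &
    forall k : R.-pker W ~> Y, (\int[semidirect Q k]_z (h z)%:E =
      \int[semidirect Q k]_z (h' z)%:E)%E].
Proof.
move=> distD [mh [N [mN QN Nlip]]].
pose h' z := h z * \1_(~` N) z.1.
have mind : measurable_fun setT (fun z : W * Y => \1_(~` N) z.1 : R).
  apply: measurableT_comp => //; apply: measurable_indic; exact: measurableC.
have mh' : measurable_fun setT h' by exact: measurable_funM.
have lip w : ~ N w -> lip1_0 (fun y => h (w, y)).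
  by move=> Nw; apply: contrapT => /Nlip.
have h'E w y : h' (w, y) = if pselect (N w) then 0 else h (w, y).
  rewrite /h' indicE/=; case: pselect => Nw /=.
    by rewrite memNset ?mulr0// => /(_ Nw).
  by rewrite mem_set ?mulr1.
exists h'; split => //.
- move=> [w y]; rewrite h'E; case: pselect => /= Nw.
    by rewrite normr0 (le_trans _ (distD y y))// eucl_dist_ge0.
  have [hl h0] := lip _ Nw; have := hl y y0.
  by rewrite h0 subr0 => /le_trans; apply; exact: distD.
- move=> w y y'; rewrite !h'E; case: pselect => /= Nw.
    by rewrite subrr eucl_dist_ge0.
  have [hl _] := lip _ Nw; exact: le_trans (ler_norm _) (hl y y').
move=> k; apply: ae_eq_integral => //; [exact/measurable_EFinP..|].
have aeN : {ae Q, forall w, ~ N w}.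
  by exists N; split => // w /= /contrapT.
apply: filterS (ae_semidirect_fst k aeN) => -[w y] /= Nw _.
by rewrite h'E; case: pselect.
Qed.

Lemma weak_duality (h : W * Y -> R)
    (a : probability ((W * Y) * (W * Y))%type R) : critics Q h ->
  ext_coupling (semidirect Q mu) (semidirect Q nu) a ->
  (\int[semidirect Q mu]_z (h z)%:E - \int[semidirect Q nu]_z (h z)%:E <=
   \int[a]_z (distY z.1.2 z.2.2)%:E)%E.
Proof.
move=> hQ [a1 a2 a3]; have [D D0 distD] := distY_bounded y0 cptY.
have [h' [mh' h'D h'lip h'int]] := critic_version distD hQ.
rewrite !h'int -(integral_law measurable_fst a1 mh').
rewrite -(integral_law measurable_snd a2 mh').
have i1 : a.-integrable setT (EFin \o (h' \o fst)).
  by apply: (bounded_integrable _ (D := D)) => [|z];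
    [exact: measurableT_comp|exact: h'D].
have i2 : a.-integrable setT (EFin \o (h' \o snd)).
  by apply: (bounded_integrable _ (D := D)) => [|z];
    [exact: measurableT_comp|exact: h'D].
have id : a.-integrable setT
    (EFin \o (fun z : (W * Y) * (W * Y) => distY z.1.2 z.2.2)).
  apply: (bounded_integrable _ (D := D)) => [|z].
    by apply: measurable_distY; exact: measurableT_comp.
  by rewrite ger0_norm ?distD// eucl_dist_ge0.
rewrite -integralB_EFin//.
pose off := [set z : (W * Y) * (W * Y) | z.1.1 <> z.2.1].
have moff : measurable off.
  rewrite -[X in measurable X]setCK; apply: measurableC.
  rewrite (_ : ~` off = (fun z : (W * Y) * (W * Y) => (z.1.1, z.2.1)) @^-1`
      [set w : W * W | w.1 = w.2]).
    rewrite -[X in measurable X]setTI.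
    apply: (@measurable_fun_pair _ _ _ _ _ _
      (fun z : (W * Y) * (W * Y) => z.1.1) (fun z => z.2.1)) => //;
      exact: measurableT_comp.
  by apply/seteqP; split => z /=; [move/contrapT|move=> ? []].
have aoff : a off = 0%E.
  rewrite (_ : off = [set z | (~` [set w : W * W | w.1 = w.2]) (z.1.1, z.2.1)])//.
  rewrite a3; last exact: measurableC.
  rewrite (_ : mkset _ = set0) ?measure0//.
  by apply/seteqP; split => // z /=; exact.
have iB : a.-integrable setT (fun z => (h' z.1)%:E - (h' z.2)%:E)%E.
  exact: (integrableB _ i1 i2).
(* The Lipschitz bound compares outcomes over a single [w], so both integrals are first restricted
   to the event where the two copies agree. *)
rewrite (negligible_integral moff _ iB)// (negligible_integral moff _ id)//.
apply: le_integral => //.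
- by apply: measurableD.
- by apply: (integrableS _ _ _ iB) => //; exact: measurableD.
- by apply: (integrableS _ _ _ id) => //; exact: measurableD.
move=> [[w y] [w' y']]; rewrite inE /off /= => -[_ /contrapT ww'].
by rewrite -EFinB lee_fin -ww'; exact: h'lip.
Qed.

End weak_duality.

Lemma measurable_bigmin d (T : measurableType d) (R : realType) (I : Type)
    (s : seq I) (x : T -> R) (f : I -> T -> R) : measurable_fun setT x ->
  (forall i, measurable_fun setT (f i)) ->
  measurable_fun setT (fun t => \big[Num.min/x t]_(i <- s) f i t).
Proof.
move=> mx mf; elim: s => [|i s IH].
  by under eq_fun do rewrite big_nil.
under eq_fun do rewrite big_cons.
exact: measurable_minr.
Qed.

Lemma measurable_invr (R : realType) :
  measurable_fun setT (fun x : R => x^-1).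
Proof.
have -> : [set: R] = [set x | x != 0] `|` [set 0].
  by apply/seteqP; split => // x _; rewrite /=; case: eqVneq; [right|left].
apply/measurable_funU => //.
  by apply: open_measurable; exact: open_neq.
split; last exact: measurable_fun_set1.
apply: open_continuous_measurable_fun; first exact: open_neq.
by move=> x; rewrite inE/= => x0; apply: continuousV.
Qed.

Lemma measurable_completion d (T : measurableType d) (R : realType) (N : nat)
    (m n : T -> 'I_N.+1 -> R) (q : 'I_N.+1 -> 'I_N.+1 -> R) i j :
  (forall i, measurable_fun setT (m ^~ i)) ->
  (forall j, measurable_fun setT (n ^~ j)) ->
  measurable_fun setT (fun t => completion (m t) (n t) q i j).
Proof.
move=> mm mn.
have mV (f : T -> R) : measurable_fun setT f ->
    measurable_fun setT (fun t => (f t)^-1).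
  by move=> mf; apply: (measurableT_comp _ mf); exact: measurable_invr.
apply: measurable_funD.
  by apply: measurable_funM => //; apply: mV; exact: measurable_funM.
apply: measurable_funM => //; apply: measurable_funM;
  apply: measurable_funB => //; apply: measurable_funM => //; exact: mV.
Qed.

Section strong_duality.
Context (R : realType) (p : nat) (Yset : set 'rV[R]_p) (y0 : set_type Yset).
Hypothesis cptY : compact Yset.
Context dW (W : measurableType dW).
Notation Y := (borel_sub y0).
Variables (Q : probability W R) (mu nu : R.-pker W ~> Y).

Let distYC (y y' : Y) : distY y y' = distY y' y.
Proof. exact: eucl_distC. Qed.

Let distY_triangle (x y z : Y) : distY x z <= distY x y + distY y z.
Proof. exact: eucl_dist_triangle. Qed.

Lemma strong_duality_approx (eps : R) : 0 < eps ->
  exists (h : W * Y -> R) (a : probability ((W * Y) * (W * Y))%type R),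
    [/\ critics Q h, ext_coupling (semidirect Q mu) (semidirect Q nu) a &
    (\int[a]_z (distY z.1.2 z.2.2)%:E <=
      \int[semidirect Q mu]_z (h z)%:E - \int[semidirect Q nu]_z (h z)%:E +
      eps%:E)%E].
Proof.
move=> eps0; have [D D0 distD] := distY_bounded y0 cptY.
(* Discretisation will cost [4 * e = eps / 2]. The other half of [eps] pays for [delta * C], where
   [C] is the factor of [delta] in [completion_gap] taken at [4 * e]. *)
pose e := eps / 8.
have e0 : 0 < e by rewrite divr_gt0.
have [N [c [idx [midx idxP]]]] := finite_net y0 cptY e0.
pose C := 1 + 4 * D + 4 * e.
have C0 : 0 < C by rewrite /C; lra.
have [delta delta01 deltaC] : exists2 delta, 0 < delta < 1 &
    delta * C <= eps / 2.
  exists (Num.min (1 / 2) (eps / (2 * C))).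
    rewrite lt_min gt_min !divr_gt0//= ?mulr_gt0//.
    by rewrite ltr_pdivrMr// mul1r ltr1n.
  rewrite -ler_pdivlMr// ge_min; apply/orP; right.
  by rewrite le_eqVlt; apply/orP; left; apply/eqP; field; rewrite gt_eqF.
have /andP[delta0 delta1] := delta01.
pose d i j := distY (c i) (c j).
have d_ge0 i j : 0 <= d i j by exact: eucl_dist_ge0.
have d_refl i : d i i = 0 by exact: eucl_distxx.
have dD i j : d i j <= D by exact: distD.
have d_tri i j l : d i l <= d i j + d j l by exact: distY_triangle.
pose mass_of (k : R.-pker W ~> Y) w i := fine (k w (cell idx i)).
have mass0 k w i : 0 <= mass_of k w i by exact: fine_ge0.
have mass1 k w : \sum_i mass_of k w i = 1.
  have kfin : fin_num_fun (k w) by exact: kernel_finite_transition.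
  have := cells_sum midx kfin measurableT; rewrite prob_kernel/= => ->.
  by apply: eq_bigr => i _; rewrite setTI.
have mmass k i : measurable_fun setT (mass_of k ^~ i).
  apply: (measurableT_comp (@fine_measurable _ setT measurableT)).
  exact: (measurable_kernel k _ (midx i)).
pose m := mass_of mu; pose n := mass_of nu.
have m0 w i : 0 <= m w i by exact: mass0.
have n0 w j : 0 <= n w j by exact: mass0.
have m1 w : \sum_i m w i = 1 by exact: mass1.
have n1 w : \sum_j n w j = 1 by exact: mass1.
have [K K0 gridK] := grid_near_optimal d_ge0 d_refl dD delta01.
pose code : countType :=
  ({ffun 'I_N.+1 * 'I_N.+1 -> nat} * {ffun 'I_N.+1 -> int})%type.
pose t0 : code := ([ffun=> 0%N], [ffun=> 0]).
(* Numbers that encode nothing are read as [t0]. This is harmless, since [Cond] tests every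
   candidate before it is selected. *)
pose dec l : code := odflt t0 (unpickle l).
pose qn l i j : R := ((dec l).1 (i, j))%:R / K%:R.
pose vn l j : R := ((dec l).2 j)%:~R / K%:R.
pose Cond l := [set w | near_optimal d delta (m w) (n w) (qn l) (vn l)].
have mCond l : measurable (Cond l).
  have mle (f g : W -> R) : measurable_fun setT f -> measurable_fun setT g ->
      measurable [set w | f w <= g w].
    move=> mf mg; rewrite -[X in measurable X]setTI.
    exact: measurable_fun_ler.
  rewrite (_ : Cond l =
    [set w | forall i, rowsum (qn l) i <= m w i] `&`
    [set w | forall j, colsum (qn l) j <= n w j] `&`
    [set w | 1 - delta <= mass (qn l)] `&` [set w | mass (qn l) < 1] `&`
    [set w | plan_cost d (qn l) <=
       \sum_i minext (vn l) (d i) * (m w i - n w i) + delta]); last first.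
    apply/seteqP; split => w; first by move=> [].
    by move=> [[[[]]]].
  have mcst (P : bool) : measurable [set _ : W | P].
    by case: P; [rewrite (_ : mkset _ = setT)|rewrite (_ : mkset _ = set0)];
      rewrite //; apply/seteqP; split.
  apply: measurableI; last first.
    apply: mle => //; apply: measurable_funD => //.
    apply: measurable_sum => i; apply: measurable_funM => //.
    by apply: measurable_funB; exact: mmass.
  apply: measurableI; last exact: mcst.
  apply: measurableI; last exact: mcst.
  by apply: measurableI; apply: measurable_forall_fin => i; apply: mle => //;
    exact: mmass.
have exCond w : exists l, Cond l w.
  have [A [B AB]] := gridK _ _ (m0 w) (n0 w) (m1 w) (n1 w).
  pose t : code := ([ffun ij => A ij.1 ij.2], [ffun j => B j]).
  exists (pickle t); rewrite /Cond/=.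
  have decE : dec (pickle t) = t by rewrite /dec pickleK.
  have -> : qn (pickle t) = (fun i j => (A i j)%:R / K%:R).
    by apply/funext => i; apply/funext => j; rewrite /qn decE/= ffunE.
  have -> // : vn (pickle t) = (fun j => (B j)%:~R / K%:R).
  by apply/funext => j; rewrite /vn decE/= ffunE.
have [k [kC mk]] := measurable_first_index mCond exCond.
pose q w := qn (k w); pose v w := vn (k w).
have q0 w i j : 0 <= q w i j by rewrite divr_ge0.
pose sigma w i j := completion (m w) (n w) (q w) i j.
have msigma i j : measurable_fun setT (fun w => sigma w i j).
  apply: (measurable_select
    (G := fun l w => completion (m w) (n w) (qn l) i j)) => // l.
  by apply: measurable_completion => ?; exact: mmass.
have sigma0 w i j : 0 <= sigma w i j.
  by have [rm cn _ lt1 _] := kC w; exact: completion_ge0.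
have sigma_nu w i : \sum_j sigma w i j * fine (nu w (cell idx j)) = 1.
  by have [rm cn _ lt1 _] := kC w; exact: completion_row.
have sigma_mu w j : \sum_i sigma w i j * fine (mu w (cell idx i)) = 1.
  by have [rm cn _ lt1 _] := kC w; exact: completion_col.
pose F l (y : Y) := minext (vn l) (fun j => distY y (c j)).
have Flip l y y' : F l y <= F l y' + distY y y'.
  by apply: minext_shift => j; rewrite -addrA lerD2l addrC.
have mF l : measurable_fun setT (F l).
  by apply: measurable_bigmin => [|j]; apply: measurable_funD => //;
    exact: measurable_distY.
pose h (z : W * Y) := F (k z.1) z.2 - F (k z.1) y0.
have mh : measurable_fun setT h.
  apply: (measurable_select (k := k \o fst)
    (G := fun l (z : W * Y) => F l z.2 - F l y0)) => l.
    by have := @measurable_fst _ _ W Y measurableT _ (mk l); rewrite setTI.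
  apply: measurable_funB => //; exact: measurableT_comp.
have hlip w y y' : `|h (w, y) - h (w, y')| <= distY y y'.
  rewrite /h/= ler_norml; have := Flip (k w) y y'; have := Flip (k w) y' y.
  by rewrite (distYC y' y); lra.
have hD z : `|h z| <= D.
  rewrite -[h z]subr0 -(subrr (F (k z.1) y0)); case: z => w y.
  exact: le_trans (hlip w y y0) (distD _ _).
have [a aE] := cell_coupling Q mu midx msigma sigma0 sigma_nu.
have cpl : ext_coupling (semidirect Q mu) (semidirect Q nu) a.
  split => [A mA|A mA|B mB].
  - apply: (cell_coupling_fst midx sigma0 sigma_nu aE) => //.
    by rewrite -[X in measurable X]setTI; exact: measurable_fst.
  - apply: (cell_coupling_snd midx sigma0 sigma_mu aE) => //.
    by rewrite -[X in measurable X]setTI; exact: measurable_snd.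
  apply: (cell_coupling_fst midx sigma0 sigma_nu aE) => //.
    have mz : measurable_fun setT
        (fun z : (W * Y) * (W * Y) => (z.1.1, z.2.1)).
      by apply: measurable_fun_pair; exact: measurableT_comp.
    by have := mz measurableT _ mB; rewrite setTI.
  have mz : measurable_fun setT (fun z : W * Y => (z.1, z.1)).
    exact: measurable_fun_pair.
  by have := mz measurableT _ mB; rewrite setTI.
exists h, a; split => //.
  split => //; apply: aeW => w; split => [y y'|]; first exact: hlip.
  by rewrite /h/= subrr.
pose f1 (z : (W * Y) * (W * Y)) := distY z.1.2 z.2.2.
pose f2 (z : (W * Y) * (W * Y)) := h z.1.
(* Evaluating at the first copy of [w] makes [f1 - f2 + f3] nonnegative everywhere, and not merely
   where the two copies agree. The law of [(z.1.1, z.2.2)] under [a] is still [semidirect Q nu]. *)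
pose f3 (z : (W * Y) * (W * Y)) := h (z.1.1, z.2.2).
have mswap : measurable_fun setT
    (fun z : (W * Y) * (W * Y) => (z.1.1, z.2.2)).
  by apply: measurable_fun_pair; exact: measurableT_comp.
have mf1 : measurable_fun setT f1.
  by apply: measurable_distY; exact: measurableT_comp.
have mf2 : measurable_fun setT f2 by exact: measurableT_comp.
have mf3 : measurable_fun setT f3 by exact: (measurableT_comp mh mswap).
have i1 : a.-integrable setT (EFin \o f1).
  apply: (bounded_integrable _ (D := D)) => // z.
  by rewrite ger0_norm ?distD// eucl_dist_ge0.
have i2 : a.-integrable setT (EFin \o f2).
  by apply: (bounded_integrable _ (D := D)) => // z; exact: hD.
have i3 : a.-integrable setT (EFin \o f3).
  by apply: (bounded_integrable _ (D := D)) => // z; exact: hD.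
have i23 : a.-integrable setT (fun z => (f2 z)%:E - (f3 z)%:E)%E.
  exact: (integrableB _ i2 i3).
have E2 : (\int[a]_z (f2 z)%:E = \int[semidirect Q mu]_z (h z)%:E)%E.
  by case: cpl => a1 _ _; exact: (integral_law measurable_fst a1 mh).
have E3 : (\int[a]_z (f3 z)%:E = \int[semidirect Q nu]_z (h z)%:E)%E.
  apply: (integral_law mswap _ mh) => A mA.
  apply: (cell_coupling_snd midx sigma0 sigma_mu aE) => //.
  by have := mswap measurableT _ mA; rewrite setTI.
rewrite -E2 -E3 -integralB_EFin//.
(* The integral of [f] is the duality gap of the pair [h], [a]; what remains is to bound it by
   [eps]. *)
pose f z := ((f1 z)%:E - ((f2 z)%:E - (f3 z)%:E))%E.
have fE z : f z = (f1 z - f2 z + f3 z)%:E.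
  by rewrite /f -!EFinB; congr (_ %:E); ring.
have -> : (\int[a]_z (f1 z)%:E =
    \int[a]_z ((f2 z)%:E - (f3 z)%:E) + \int[a]_z f z)%E.
  rewrite [X in (_ + X)%E]integralB// addeC subeK//.
  by apply: integrable_fin_num.
rewrite leeD2l//.
pose Fc w i := minext (v w) (d i).
apply: (cell_coupling_le midx msigma sigma0 aE
  (g := fun w i j => d i j - Fc w i + Fc w j + 4 * e)).
- rewrite (funext fE); apply/measurable_EFinP.
  by apply: measurable_funD => //; exact: measurable_funB.
- move=> [[w y] [w' y']]; rewrite fE lee_fin /f1 /f2 /f3 /=.
  by have := hlip w y y'; rewrite ler_norml => /andP[_]; lra.
- move=> w i j; have := minext_lip (v w) d_tri i j.
  by rewrite -/(Fc w i) -/(Fc w j); lra.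
(* Moving both outcomes to their centres costs [2 * e] in the distance and [e] in each value of the
   potential; the recentring at [y0] cancels. *)
- move=> w y y'; rewrite fE lee_fin /f1 /f2 /f3 /h /=.
  have : Fc w (idx y) <= F (k w) y + e.
    apply: le_trans (Flip (k w) (c (idx y)) y) _.
    by rewrite lerD2l distYC.
  have : F (k w) y' <= Fc w (idx y') + e.
    apply: le_trans (Flip (k w) y' (c (idx y'))) _.
    by rewrite lerD2l.
  have := distY_triangle y (c (idx y)) y'.
  have := distY_triangle (c (idx y)) (c (idx y')) y'.
  have := idxP y; have := idxP y'; rewrite (distYC y' _) /d; lra.
- move=> w; have [c1 c2 c3 c4 c5] := kC w.
  have e40 : 0 <= 4 * e by lra.
  apply: le_trans (completion_gap (m1 w) (n1 w) (q0 w) c4 c1 c2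
    d_ge0 dD d_tri e40 c3 c5) _.
  by move: deltaC; rewrite /C /e; lra.
Qed.

Hypothesis mdiag : measurable [set w : W * W | w.1 = w.2].

Theorem ext_kantorovich_duality :
  ereal_sup [set (\int[semidirect Q mu]_z (h z)%:E -
                  \int[semidirect Q nu]_z (h z)%:E)%E
            | h in @critics R p Yset y0 dW W Q] =
  eW1 (semidirect Q mu) (semidirect Q nu).
Proof.
apply/eqP; rewrite eq_le; apply/andP; split.
  apply/ereal_supP => _ [h hQ <-]; apply/ereal_infP => _ [a acpl <-].
  exact: (weak_duality cptY mdiag hQ acpl).
apply/lee_addgt0Pr => eps eps0.
have [h [a [hQ acpl ah]]] := strong_duality_approx eps0.
apply: (@le_trans _ _ (\int[a]_z (distY z.1.2 z.2.2)%:E)%E).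
  by apply: ereal_inf_lbound; exists a.
apply: le_trans ah _; rewrite leeD2r//.
by apply: ereal_sup_ubound; exists h.
Qed.

End strong_duality.

(** * The law of the observed data and of the generated data *)

(** Off the diagonal, some basic open set contains the first point and not the second. The
    complement of the diagonal is thus a countable union of rectangles, indexed by the rank of the
    basic set. *)
Lemma standard_borel_diag (R : realType) d (T : measurableType d) :
  standard_borel R T -> measurable [set w : T * T | w.1 = w.2].
Proof.
move=> [S [f [hS [B /countable_injP[rk rk_inj] [Bopen Bbase]] fbij fmeas]]].
have mB U : B U -> measurable (f @^-1` U).
  by move=> BU; apply/(fmeas U).1; apply: sub_sigma_algebra; exact: Bopen.
pose V n := [set w : T * T |
  exists U, [/\ B U, rk U = n, U (f w.1) & ~ U (f w.2)]].
have mV n : measurable (V n).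
  have [[U [BU rkU]]|noU] := pselect (exists U, B U /\ rk U = n); last first.
    rewrite (_ : V n = set0)//; apply/seteqP; split => // w [U [BU rkU _ _]].
    by apply: noU; exists U.
  rewrite (_ : V n = (f @^-1` U) `*` (~` (f @^-1` U))).
    by apply: measurableX; [exact: mB|apply: measurableC; exact: mB].
  apply/seteqP; split => [w [U' [BU' rkU' U'1 U'2]]|w [U1 U2]]; last by exists U.
  have -> : U = U' by apply: rk_inj; rewrite ?inE// rkU.
  by [].
rewrite -[X in measurable X]setCK; apply: measurableC.
rewrite (_ : ~` _ = \bigcup_n V n); first by apply: bigcup_measurable => n _.
apply/seteqP; split => [w /= w12|w [n _ [U [_ _ U1 U2]]] /= w12]; last first.
  by apply: U2; rewrite -w12.
have f12 : f w.1 != f w.2.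
  by apply/eqP => /(bij_inj fbij).
move: hS; rewrite open_hausdorff => /(_ _ _ f12)[[A1 A2] /= [A1f A2f]].
move=> [oA1 _ /eqP A12]; move: A1f A2f; rewrite !inE => A1f A2f.
have [U [BU U1] UA1] := Bbase _ _ (open_nbhs_nbhs (conj oA1 A1f)).
exists (rk U) => //; exists U; split => // U2.
have : (A1 `&` A2) (f w.2) by split => //; exact: UA1.
by rewrite A12.
Qed.

Lemma diag_prod d1 d2 (T1 : measurableType d1) (T2 : measurableType d2) :
  measurable [set w : T1 * T1 | w.1 = w.2] ->
  measurable [set w : T2 * T2 | w.1 = w.2] ->
  measurable [set w : (T1 * T2) * (T1 * T2) | w.1 = w.2].
Proof.
move=> m1 m2.
have mz1 : measurable_fun setT
    (fun w : (T1 * T2) * (T1 * T2) => (w.1.1, w.2.1)).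
  by apply: measurable_fun_pair; exact: measurableT_comp.
have mz2 : measurable_fun setT
    (fun w : (T1 * T2) * (T1 * T2) => (w.1.2, w.2.2)).
  by apply: measurable_fun_pair; exact: measurableT_comp.
have := measurableI _ _ (mz1 measurableT _ m1) (mz2 measurableT _ m2).
rewrite !setTI; congr (measurable _).
by apply/seteqP; split => -[[a b] [a' b']] /=; [move=> [-> ->]|move=> [-> ->]].
Qed.

Lemma diag_set1 d (T : measurableType d) :
  measurable [set w : T * T | w.1 = w.2] -> forall s : T, measurable [set s].
Proof.
move=> mdiag s; have := measurable_pair1 s measurableT mdiag.
by rewrite setTI; congr (measurable _); apply/seteqP; split => a /=.
Qed.

(** * The observed law for a discrete treatment *)

Section levels.
Context d dT (O : measurableType d) (T : measurableType dT) (R : realType).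
Variables (P : probability O R) (t : O -> T) (D : set T).
Hypothesis mt : measurable_fun setT t.
Hypothesis mset1 : forall s : T, measurable [set s].
Hypothesis cD : countable D.
Hypothesis aeD : {ae P, forall o, D (t o)}.

(** Up to a [P]-null set, which both measures ignore, the levels of [t] form a countable partition.
    Ranking [D] by integers makes each [F n] one level or empty. *)
Lemma eq_measure_levels (m1 m2 : {measure set O -> \bar R}) :
  (forall S, measurable S -> P S = 0 -> m1 S = 0)%E ->
  (forall S, measurable S -> P S = 0 -> m2 S = 0)%E ->
  (forall s, D s -> m1 (t @^-1` [set s]) = m2 (t @^-1` [set s])) ->
  m1 setT = m2 setT.
Proof.
move=> dom1 dom2 m12; have /countable_injP[rk rk_inj] := cD.
pose F n := t @^-1` [set s | D s /\ rk s = n].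
have FE n : (exists2 s, D s & F n = t @^-1` [set s]) \/ F n = set0.
  have [[s [Ds rks]]|nos] := pselect (exists s, D s /\ rk s = n).
    left; exists s => //; apply/seteqP; split => [z [Dt rkt]|z /= tz]; last first.
      by rewrite /F/= tz.
    by apply: rk_inj; rewrite ?inE// rks.
  right; apply/seteqP; split => // o [Dt rkt].
  by apply: nos; exists (t o).
have mF n : measurable (F n).
  have [[s _ ->]|->//] := FE n.
  by have := mt measurableT (mset1 s); rewrite setTI.
have tF : trivIset setT F.
  apply/trivIsetP => i j _ _ /eqP ij; rewrite -subset0 => z [[_ zi] [_ zj]].
  by apply: ij; rewrite -zi -zj.
pose G := \bigcup_n F n.
have mG : measurable G by apply: bigcup_measurable => n _; exact: mF.
have PG : P (~` G) = 0%E.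
  have [N [mN PN NG]] := aeD.
  apply/eqP; rewrite -measure_le0 -PN le_measure// ?inE//.
    exact: measurableC.
  by move=> o /= nG; apply: NG => /= Dto; apply: nG; exists (rk (t o)).
have mGT (m : {measure set O -> \bar R}) :
    (forall S, measurable S -> P S = 0 -> m S = 0)%E -> m setT = m G.
  move=> dom; rewrite -(setvU G) setUC measureU0//.
    exact: measurableC.
  by apply: dom => //; exact: measurableC.
rewrite (mGT m1)// (mGT m2)// !measure_semi_bigcup//.
apply: eq_eseriesr => n _.
by have [[s Ds ->]|->] := FE n; [exact: m12|rewrite !measure0].
Qed.

End levels.

Section cond_prob.
Context (R : realType) d dX (O : measurableType d) (X : measurableType dX).
Variables (P : probability O R) (x : {RV P >-> X}).

(** The Radon-Nikodym derivative of [P(x in A, E)] with respect to the law of [x]. Since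
    [cond_indep] quantifies over given versions, versions must be produced before it can be
    applied. *)
Lemma exists_cond_prob_version (E : set O) : measurable E ->
  exists g : X -> R, [/\ measurable_fun setT g, (forall a, 0 <= g a) &
    cond_prob_version x E (EFin \o g)].
Proof.
move=> mE; pose n0 := pushforward (mrestr P mE) x.
have n0E A : n0 A = P (x @^-1` A `&` E) by [].
have mx A : measurable A -> measurable (x @^-1` A).
  by move=> mA; rewrite -[X in measurable X]setTI; exact: measurable_funPT.
have n0fin : fin_num_fun n0.
  move=> A mA; rewrite n0E fin_num_measure//.
  by apply: measurableI => //; exact: mx.
have [n nE'] := pack_finite_measure n0fin.
have nE A : n A = P (x @^-1` A `&` E) by rewrite nE'.
have ndom : n `<< distribution P x.
  apply/null_content_dominatesP => A mA PA; apply/eqP.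
  rewrite nE -measure_le0 -PA /distribution/pushforward le_measure// ?inE//.
  - by apply: measurableI => //; exact: mx.
  - exact: mx.
pose f := Radon_Nikodym_SigmaFinite.f n (distribution P x).
have ffin a : f a \is a fin_num by exact: Radon_Nikodym_SigmaFinite.f_fin_num.
have f0 a : (0 <= f a)%E by exact: Radon_Nikodym_SigmaFinite.f_ge0.
have mf : measurable_fun setT f.
  exact: measurable_int (Radon_Nikodym_SigmaFinite.f_integrable ndom).
exists (fine \o f); split.
- exact: measurableT_comp.
- by move=> a; exact: fine_ge0.
have -> : EFin \o (fine \o f) = f by apply/funext => a /=; rewrite fineK.
split => // A mA.
by rewrite -nE; exact: (Radon_Nikodym_SigmaFinite.f_integral ndom mA).
Qed.

End cond_prob.

Section objective.
Context (R : realType) (p : nat) (Yset : set 'rV[R]_p) (y0 : set_type Yset).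
Notation Y := (borel_sub y0).
Local Open Scope ereal_scope.

(** By independence the joint law of [w] and [u] is a product measure, whose sections in [w] are the
    values of [gen_kernel]. *)
Lemma distribution_gen_kernel dW (W : measurableType dW) dV
    (V : measurableType dV) (g : {mfun (W * V)%type >-> Y})
    dO (O : measurableType dO) (P : probability O R) (w : {RV P >-> W})
    (u : {RV P >-> V}) (Q : probability W R) (A : set (W * Y)) :
  (forall B, measurable B -> distribution P w B = Q B) ->
  indep_rv P w u -> measurable A ->
  P [set o | A (w o, g (w o, u o))] =
  semidirect Q (gen_kernel (distribution P u) g) A.
Proof.
move=> wQ wu mA.
pose G (z : W * V) := (z.1, g z).
have mG : measurable_fun setT G by exact: measurable_fun_pair.
have mGA : measurable (G @^-1` A).
  by have := mG measurableT A mA; rewrite setTI.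
transitivity ((Q \x distribution P u) (G @^-1` A)).
  rewrite (@product_measure_unique _ _ _ _ _ Q (distribution P u)
    (distribution P (pair_rv w u)))// => B C mB mC.
  transitivity (distribution P w B * distribution P u C); first exact: wu.
  by rewrite (wQ B mB).
rewrite /product_measure1/= /semidirect; apply: eq_integral => a _.
rewrite /= /gen_kernel /distribution /pushforward /=; congr (P _).
Qed.

Context dW (W : measurableType dW).
Variables (Qobs Qrho : probability W R) (rho : W -> R) (mu : R.-pker W ~> Y).
Hypothesis Qrho_dom : Qrho `<< Qobs.
Hypothesis mrho : measurable_fun setT rho.
Hypothesis rho_density : ae_eq Qobs setT (EFin \o rho)
  (Radon_Nikodym (charge_of_finite_measure Qrho) Qobs).
Hypothesis rho_ge0 : {ae Qobs, forall w, 0 <= rho w}%R.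

Lemma integral_reweighted (h : W * Y -> R) : measurable_fun setT h ->
  \int[semidirect Qobs mu]_z (rho z.1 * h z)%:E =
  \int[semidirect Qrho mu]_z (h z)%:E.
Proof.
(* The ratio [rho] is nonnegative only almost everywhere; its positive part is a density that is
   nonnegative at every point. *)
move=> mh; pose r w := Num.max (rho w) 0%R.
have mr : measurable_fun setT r by exact: measurable_maxr.
have r0 w : (0 <= r w)%R by rewrite le_max lexx orbT.
have mr1 : measurable_fun setT (fun z : W * Y => r z.1).
  exact: measurableT_comp.
have rE : {ae Qobs, forall w, r w = rho w}.
  by apply: filterS rho_ge0 => w rw; rewrite /r max_l.
have QrhoE A : measurable A -> Qrho A = \int[Qobs]_(w in A) (r w)%:E.
  move=> mA.
  rewrite -[LHS]/(charge_of_finite_measure Qrho A).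
  rewrite (Radon_Nikodym_integral (mu := Qobs))//.
  apply: ae_eq_integral => //.
  - exact: measurable_funTS.
  - by apply: measurable_funTS; exact/measurable_EFinP.
  apply: filterS2 rho_density rE => w /(_ I) /= <- -> //.
have mur A : measurable A -> semidirect Qrho mu A =
    \int[semidirect Qobs mu]_(z in A) (r z.1)%:E.
  move=> mA.
  have -> : semidirect Qrho mu A = \int[Qrho]_w mu w (xsection A w) by [].
  rewrite (integral_density mr r0 QrhoE)//; last first.
    by apply: measurable_fun_xsection_finite_kernel; rewrite inE.
  rewrite [RHS]integral_mkcond integral_semidirect//.
  - apply: eq_integral => w _.
    transitivity (\int[mu w]_y ((r w)%:E * (\1_(xsection A w) y)%:E)).
      rewrite ge0_integralZl_EFin//.
      + rewrite (integral_indic _ measurableT (measurable_xsection w mA)).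
        by rewrite setIT; exact: muleC.
      + apply/measurable_EFinP; apply: measurable_indic.
        exact: measurable_xsection.
    apply: eq_integral => y _; rewrite /patch indicE mem_xsection.
    by case: ifPn => _; rewrite ?mule1 ?mule0.
  - apply/(measurable_restrictT _ mA); apply: measurable_funTS.
    exact/measurable_EFinP.
  - by move=> z; rewrite /patch; case: ifPn => // _; rewrite lee_fin.
rewrite (integral_density_real mr1 (fun z => r0 z.1) mur)//.
apply: ae_eq_integral => //.
- apply/measurable_EFinP; apply: measurable_funM => //.
  exact: measurableT_comp.
- by apply/measurable_EFinP; exact: measurable_funM.
by apply: filterS (ae_semidirect_fst mu rE) => z rz _; rewrite rz mulrC.
Qed.

End objective.

Lemma eq_measure_ae d (T : measurableType d) (R : realType)
    (P : {measure set T -> \bar R}) (A B : set T) :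
  measurable A -> measurable B -> {ae P, forall x, A x <-> B x} -> P A = P B.
Proof.
move=> mA mB AB; rewrite -(setIT A) -(setIT B) -!integral_indic//.
apply: ae_eq_integral => //;
  try by apply/measurable_EFinP; exact: measurable_indic.
apply: filterS AB => x ABx _; congr (_ %:E); rewrite !indicE.
by congr ((nat_of_bool _)%:R); apply/idP/idP; rewrite !inE => /ABx.
Qed.

Section observed_law.
Context (R : realType) dO dX dT dY (O : measurableType dO)
  (X : measurableType dX) (T : measurableType dT) (Y : measurableType dY).
Variables (P : probability O R) (x : {RV P >-> X}) (t : {RV P >-> T}).
Variables (y : T -> {RV P >-> Y}) (yobs : {RV P >-> Y}).
Variable mu : R.-pker (X * T)%type ~> Y.
Variable D : set T.
Hypothesis mset1 : forall s : T, measurable [set s].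
Hypothesis cD : countable D.
Hypothesis aeD : {ae P, forall o, D (t o)}.
Hypothesis consistency : {ae P, forall o, yobs o = y (t o) o}.
Hypothesis ignorability : forall s : T, cond_indep x (y s) t.
Hypothesis mu_law : forall s : T, regular_cond_law x (y s) (fun a => mu (a, s)).
Local Open Scope ereal_scope.

Let mpre d1 (U : measurableType d1) (f : {RV P >-> U}) B : measurable B ->
  measurable (f @^-1` B).
Proof.
by move=> mB; rewrite -[X in measurable X]setTI; exact: measurable_funPT.
Qed.

Let mufin w : fin_num_fun (mu w).
Proof. exact: kernel_finite_transition. Qed.

Let W : {RV P >-> (X * T)%type} := pair_rv x t.

(** On the level [t = s], consistency replaces [yobs] by [y s], and [W] is [(x, s)]. The law of
    [y s] given [x] is known up to a null set depending on [s], which is why the levels are treated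
    one at a time. *)
Let observed_level (s : T) (C : set (X * T)) (B : set Y) :
  measurable C -> measurable B ->
  P (t @^-1` [set s] `&` (W @^-1` C `&` yobs @^-1` B)) =
  \int[P]_(o in t @^-1` [set s]) (fine (mu (W o) B) * \1_C (W o))%:E.
Proof.
move=> mC mB; pose Es := t @^-1` [set s].
have mEs : measurable Es by exact: mpre.
pose A := [set a | C (a, s)].
have mA : measurable A.
  by have := measurable_pair2 s measurableT mC; rewrite setTI.
pose f a := mu (a, s) B.
have [mf f0 fP] := mu_law s mB.
have ffin a : f a \is a fin_num.
  exact: mufin.
have [g [mg g0 gE]] := exists_cond_prob_version x mEs.
have mE : measurable ((y s) @^-1` B `&` Es).
  by apply: measurableI => //; exact: mpre.
have [h [mh h0 hE]] := exists_cond_prob_version x mE.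
(* The conditional probability of [y s] in [B] together with [t = s] splits into [mu (a, s) B] and
   that of [t = s]. *)
have hfg := ignorability mB (mset1 s) (mu_law s mB) gE hE.
transitivity (P (x @^-1` A `&` ((y s) @^-1` B `&` Es))).
  apply: eq_measure_ae.
  - by apply: measurableI => //; apply: measurableI; exact: mpre.
  - by apply: measurableI => //; exact: mpre.
  apply: filterS consistency => o yo; split => /= [[ts [Co Bo]]|[Ao [Bo ts]]].
    by rewrite /A/= -ts; split => //; rewrite -yo.
  by move: Ao; rewrite /A/= -ts => Ao; split => //; split => //; rewrite yo ts.
have [_ _ hP] := hE; have [_ _ gP] := gE.
rewrite hP// integral_mkcond.
pose psi a := (fine (f a) * \1_A a)%R.
have mpsi : measurable_fun setT psi.
  apply: measurable_funM; last exact: measurable_indic.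
  exact: measurableT_comp.
have psi0 a : (0 <= psi a)%R by rewrite mulr_ge0// fine_ge0.
transitivity (\int[distribution P x]_a ((psi a)%:E * (g a)%:E)).
  apply: ae_eq_integral => //.
  - apply/(measurable_restrictT _ mA); apply: measurable_funTS.
    exact/measurable_EFinP.
  - by apply: emeasurable_funM; exact/measurable_EFinP.
  apply: filterS hfg => a /(_ I) /= ha _; rewrite /patch /psi indicE.
  case: ifPn => aA; last by rewrite mulr0 mul0e.
  by rewrite mulr1 fineK.
(* By definition [g] is the density of the law of [x] restricted to the level. This turns the
   integral over [X] back into one over the level. *)
pose n := pushforward (mrestr P mEs) x.
have nE B' : measurable B' -> n B' = \int[distribution P x]_(a in B') (g a)%:E.
  by move=> mB'; rewrite -gP.
have mpsi' : measurable_fun setT (EFin \o psi) by exact/measurable_EFinP.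
have psi0' a : 0 <= (EFin \o psi) a by rewrite lee_fin.
rewrite -(integral_density mg g0 nE mpsi' psi0').
have mx : measurable_fun setT x by exact: measurable_funPT.
rewrite -(ge0_integral_law (a := mrestr P mEs) mx _ mpsi' psi0')//.
have rE S : measurable S ->
    mrestr P mEs S = \int[P]_(o in S) (\1_Es o)%:E.
  by move=> mS; rewrite integral_indic// setIC.
have mpx : measurable_fun setT (fun o => (psi (x o))%:E).
  exact: (measurableT_comp mpsi' mx).
rewrite (integral_density _ _ rE mpx)//; first last.
  by move=> o; exact: psi0'.
rewrite [RHS]integral_mkcond; apply: eq_integral => o _.
rewrite /patch indicE; case: ifPn => oEs; last by rewrite mule0.
rewrite mule1 /psi /f /W/= /pair_rv; move: oEs; rewrite inE /Es/= => ->.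
by congr ((_ * _)%:E); rewrite !indicE; congr ((nat_of_bool _)%:R);
  apply/idP/idP; rewrite !inE.
Qed.

Lemma observed_law_discrete (A : set ((X * T) * Y)) : measurable A ->
  distribution P (pair_rv W yobs) A = semidirect (distribution P W) mu A.
Proof.
move: A; apply: (@measure_unique_rect _ _ _ _ _ (distribution P (pair_rv W yobs))
  (semidirect (distribution P W) mu)) => C B mC mB.
have mG : measurable (W @^-1` C `&` yobs @^-1` B).
  by apply: measurableI; exact: mpre.
pose phi w := (fine (mu w B) * \1_C w)%R.
have mphi : measurable_fun setT phi.
  apply: measurable_funM; last exact: measurable_indic.
  by apply: measurableT_comp => //; exact: measurable_kernel.
have phi0 w : (0 <= phi w)%R by rewrite mulr_ge0// fine_ge0.
have mW : measurable_fun setT W by exact: measurable_funPT.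
have mphiW : measurable_fun setT (phi \o W) by exact: measurableT_comp.
(* For a fixed rectangle both sides become total masses of measures on [O]: [P] restricted to the
   event, and [P] with density [phi \o W]. They can then be compared level by level. *)
have [m2 m2E] := density_measure P mphiW (fun o => phi0 (W o)).
transitivity (mrestr P mG setT).
  rewrite /mrestr setTI; congr (P _).
transitivity (m2 setT); last first.
  rewrite m2E (ge0_integral_law (P := distribution P W) mW _ (f := EFin \o phi))//.
  - apply: eq_integral => w _.
    rewrite /= /phi indicE; case: (boolP (w \in C)) => wC.
      rewrite in_xsectionX// mulr1 fineK//; exact: mufin.
    by rewrite notin_xsectionX// measure0 mulr0.
  - exact/measurable_EFinP.
apply: (eq_measure_levels (P := P) (t := t) (D := D)) => //.
- move=> S mS PS; apply/eqP; rewrite -measure_le0 -[leRHS]PS.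
  have : P (S `&` (W @^-1` C `&` yobs @^-1` B)) <= P S.
    by rewrite le_measure// inE//; exact: measurableI.
  exact.
- by move=> S mS PS; rewrite m2E null_set_integral//; apply: measurable_funTS;
    exact/measurable_EFinP.
by move=> s _; rewrite m2E -observed_level.
Qed.

End observed_law.

Theorem mainTheorem5 (R : realType)
  (* the compact outcome space and its base point *)
  (p : nat) (Yset : set 'rV[R]_p) (cptY : compact Yset) (y0 : set_type Yset)
  (* covariates, treatments, potential and observed outcomes *)
  (dO dX dT : measure_display)
  (O : measurableType dO) (X : measurableType dX) (T : measurableType dT)
  (sbX : standard_borel R X) (sbT : standard_borel R T)
  (P : probability O R) (x : {RV P >-> X}) (t : {RV P >-> T})
  (y : T -> {RV P >-> borel_sub y0}) (yobs : {RV P >-> borel_sub y0})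
  (consistency : {ae P, forall o, yobs o = y (t o) o})
  (ignorability : forall s : T, cond_indep x (y s) t)
  (* the laws of the potential outcomes given the covariates *)
  (mu : R.-pker (X * T)%type ~> borel_sub y0)
  (mu_law : forall s : T, regular_cond_law x (y s) (fun a => mu (a, s)))
  (* (w, yobs) has law Qobs(dw) mu_w(dy): this follows from the hypotheses
     above when the treatment is discrete, but not in general, since they
     constrain mu only up to a null set for each treatment level *)
  (mu_obs : (exists2 D : set T, countable D & {ae P, forall o, D (t o)}) \/
     forall A, measurable A ->
       distribution P (pair_rv (pair_rv x t) yobs) A =
       semidirect (distribution P (pair_rv x t)) mu A)
  (* target law and overlap *)
  (Qrho : probability (X * T)%type R) (rho : X * T -> R) (kappa : R)
  (kappa01 : 0 < kappa <= 1)
  (Qrho_dom : Qrho `<< distribution P (pair_rv x t))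
  (mrho : measurable_fun setT rho)
  (rho_density : ae_eq (distribution P (pair_rv x t)) setT (EFin \o rho)
     (Radon_Nikodym (charge_of_finite_measure Qrho)
        (distribution P (pair_rv x t))))
  (rho_bound : {ae distribution P (pair_rv x t),
     forall w, 0 <= rho w <= kappa^-1})
  (* generator, noise and target covariates *)
  (dU : nat) (g : {mfun ((X * T) * unit_cube R dU)%type >-> borel_sub y0})
  (dO' : measure_display) (O' : measurableType dO') (P' : probability O' R)
  (wt : {RV P' >-> (X * T)%type}) (u : {RV P' >-> unit_cube R dU})
  (wt_law : forall A, measurable A -> distribution P' wt A = Qrho A)
  (u_law : uniform_on_cube P' u)
  (wt_u_indep : indep_rv P' wt u) :
  ereal_sup [set objective P P' (pair_rv x t) yobs wt u rho g h
            | h in critics Qrho] =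
  eW1 (semidirect Qrho mu) (semidirect Qrho (gen_kernel (distribution P' u) g)).
Proof.
have mset1 := diag_set1 (standard_borel_diag sbT).
have mdiag := diag_prod (standard_borel_diag sbX) (standard_borel_diag sbT).
have law A : measurable A -> distribution P (pair_rv (pair_rv x t) yobs) A =
    semidirect (distribution P (pair_rv x t)) mu A.
  case: mu_obs => [[D cD aeD]|]; last exact.
  exact: (observed_law_discrete mset1 cD aeD consistency ignorability mu_law).
have rho_ge0 : {ae distribution P (pair_rv x t), forall w, 0 <= rho w}.
  by apply: filterS rho_bound => w /andP[].
pose phi o := (wt o, g (wt o, u o)).
have mphi : measurable_fun setT phi.
  apply: measurable_fun_pair => //; apply: measurableT_comp => //.
  exact: measurable_fun_pair.
have phi_law A : measurable A -> P' (phi @^-1` A) =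
    semidirect Qrho (gen_kernel (distribution P' u) g) A.
  exact: distribution_gen_kernel.
(* Both suprema range over the same critics, so it suffices to identify the two expectations for
   each measurable [h]. *)
rewrite -(ext_kantorovich_duality cptY _ _ _ mdiag); congr ereal_sup.
apply: eq_imagel => h [mh _]; rewrite /objective !unlock; congr (_ - _)%E.
  rewrite -(integral_reweighted mu Qrho_dom mrho rho_density rho_ge0 mh).
  have mW : measurable_fun setT (pair_rv (pair_rv x t) yobs).
    exact: measurable_funPT.
  have mrh : measurable_fun setT (fun z => rho z.1 * h z).
    by apply: measurable_funM => //; exact: measurableT_comp.
  exact: (integral_law mW law mrh).
exact: (integral_law mphi phi_law mh).
Qed.
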